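(* Let $n\in\mathbb{N}$ and let $\pi\in \mathbb{S}_n$. Suppose that either one of the following conditions holds: (i) the order of $\pi$ is odd, or (ii) all cycles in the decomposition of $\pi$ as a product of disjoint cycles have odd order (length) except for exactly two transpositions. Then $\dim \mathfrak{B}(\mathcal{O}_{\pi}, \rho) = \infty$ for every irreducible complex representation $\rho$ of the centralizer $\mathbb{S}_n^{\pi}$ of $\pi$ in $\mathbb{S}_n$.
   Context: All vector spaces and representations are over $\mathbb{C}$. $\mathbb{S}_n$ is the symmetric group on $\{1,\dots,n\}$, $\mathcal{O}_\pi$ is the conjugacy class of $\pi$ in $\mathbb{S}_n$, and $\mathbb{S}_n^\pi$ is the centralizer of $\pi$. Yetter-Drinfeld modules: for a finite group $G$, a Yetter-Drinfeld module over $G$ is a $G$-graded vector space $M=\oplus_{h\in G}M_h$ with a linear $G$-action such that $g\cdot M_h\subseteq M_{ghg^{-1}}$. It is a braided vector space with $c(x\otimes y)=(h\cdot y)\otimes x$ for $x\in M_h$, $y\in M$. For a conjugacy class $\mathcal{C}$ of $G$, a fixed $s\in\mathcal{C}$ with centralizer $G^s$, and an irreducible representation $\rho$ of $G^s$ on $V$, the irreducible Yetter-Drinfeld module $M(\mathcal{C},\rho)$ is defined as follows. Enumerate $\mathcal{C}=\{t_1=s,\dots,t_M\}$ and choose $g_i\in G$ with $g_isg_i^{-1}=t_i$. Then $M(\mathcal{C},\rho)=\oplus_{1\le i\le M}\, g_i\otimes V$, where $g_iv:=g_i\otimes v$ has degree $t_i$, and $g\cdot(g_iv)=g_j(\rho(\gamma)v)$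 where $gg_i=g_j\gamma$ with $\gamma\in G^s$. Here one uses $G=\mathbb{S}_n$, $\mathcal{C}=\mathcal{O}_\pi$, $s=\pi$. Nichols algebras: for a braided vector space $(V,c)$, put $c_i=\mathrm{id}^{\otimes(i-1)}\otimes c\otimes\mathrm{id}^{\otimes(m-i-1)}$ on $V^{\otimes m}$. For $w\in\mathbb{S}_m$ with reduced expression $w=s_{i_1}\cdots s_{i_k}$ in the simple transpositions $s_i=(i\ i+1)$ put $c_w=c_{i_1}\cdots c_{i_k}$ (well defined by the braid equation). The Nichols algebra is $\mathfrak{B}(V)=\oplus_{m\ge0}V^{\otimes m}/\ker\big(\sum_{w\in\mathbb{S}_m}c_w\big)$, a quotient algebra of the tensor algebra $T(V)$. One writes $\mathfrak{B}(\mathcal{C},\rho):=\mathfrak{B}(M(\mathcal{C},\rho))$; $\dim$ means dimension over $\mathbb{C}$. *)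

(* Defs.v *)
From HB Require Import structures.
From mathcomp Require Import all_boot all_order all_algebra all_fingroup.
From mathcomp Require Import mxrepresentation.
From mathcomp Require Import reals.
From mathcomp Require Import complex.
From mathcomp Require Import finmap monalg.

Set Implicit Arguments.
Unset Strict Implicit.
Unset Printing Implicit Defensive.

Import GRing.Theory.
Local Open Scope ring_scope.

Section ReducedExpressions.
Variable m : nat.

Fact adj_lo (k : 'I_m.-1) : (k < m)%N.
Proof. by case: m k => [|p] [k /= lt_k] //; apply: leqW. Qed.

Fact adj_hi (k : 'I_m.-1) : (k.+1 < m)%N.
Proof. by case: m k => [|p] [k /= lt_k]. Qed.

Definition adj (k : 'I_m.-1) : 'S_m :=
  tperm (Ordinal (adj_lo k)) (Ordinal (adj_hi k)).

Definition expression_of (w : 'S_m) (s : seq 'I_m.-1) : bool :=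
  w == (\prod_(k <- s) adj k)%g.

Fact expression_exists w :
  exists l, [exists s : l.-tuple 'I_m.-1, expression_of w s].
Proof.
suff [s ws]: exists s, expression_of w s.
  by exists (size s); apply/existsP; exists (in_tuple s).
have adjP d (i j : 'I_m) : (j = i + d :> nat)%N ->
    exists s, expression_of (tperm i j) s.
  elim: d j => [|d IHd] j; rewrite (addn0, addnS) => Dj.
    by exists [::]; rewrite /expression_of big_nil (ord_inj Dj) tperm1.
  have lt_j : (i + d < m)%N by rewrite ltnW // -Dj.
  have lt_k : (i + d < m.-1)%N by rewrite -ltnS (ltn_predK lt_j) -Dj.
  pose j' := Ordinal lt_j; pose k := Ordinal lt_k.
  have adjk : adj k = tperm j' j.
    by congr (tperm _ _); apply: ord_inj; rewrite /= ?Dj.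
  have [s /eqP ijs] := IHd j' erefl.
  case: d => [|d] in IHd lt_j lt_k j' k adjk ijs Dj *.
    exists [:: k]; rewrite /expression_of big_seq1 adjk; apply/eqP.
    by congr (tperm _ _); apply: ord_inj; rewrite /= addn0.
  exists (k :: rcons s k); rewrite /expression_of big_cons big_rcons /=.
  rewrite -ijs adjk -{1}[tperm j' j]tpermV -conjgE tpermJ tpermL tpermD //.
    by rewrite -val_eqE /= -[X in _ != X]addn0 eqn_add2l.
  by rewrite -val_eqE /= Dj -addnS -[X in _ != X]addn0 eqn_add2l.
have tpermE i j : exists s, expression_of (tperm i j) s.
  case/orP: (leq_total i j) => /subnKC E; first exact: adjP (esym E).
  by rewrite tpermC; apply: adjP (esym E).
have [ts -> _] := prod_tpermP w.
elim: ts => [|t ts [s /eqP IHs]]; first by exists [::]; rewrite /expression_of !big_nil.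
have [s' /eqP Ds'] := tpermE t.1 t.2.
by exists (s' ++ s); rewrite /expression_of big_cat big_cons IHs -Ds'.
Qed.

Definition perm_length (w : 'S_m) : nat := ex_minn (expression_exists w).

Fact reduced_exists w :
  exists s : (perm_length w).-tuple 'I_m.-1, expression_of w s.
Proof. by rewrite /perm_length; case: ex_minnP => l /existsP. Qed.

Definition reduced_expression (w : 'S_m) : seq 'I_m.-1 :=
  xchoose (reduced_exists w).

Lemma reduced_expressionP w :
  w = (\prod_(k <- reduced_expression w) adj k)%g.
Proof. exact/eqP/(xchooseP (reduced_exists w)). Qed.

Lemma reduced_expression_min w s :
  w = (\prod_(k <- s) adj k)%g -> (size (reduced_expression w) <= size s)%N.
Proof.
move=> Dw; rewrite size_tuple /perm_length; case: ex_minnP => l _; apply.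
by apply/existsP; exists (in_tuple s); apply/eqP.
Qed.

End ReducedExpressions.

Section Nichols.
Variables (F : fieldType) (I : finType).

(* T(V) for the vector space V with basis I: the word i1 ... im is the basis
   vector i1 (x) ... (x) im of V^{(x)m}. *)
Definition tensor_algebra := {malg F[{fmonom I}]}.
HB.instance Definition _ := GRing.Lmodule.on tensor_algebra.

Definition tensor (w : seq I) : tensor_algebra := << FMonom w >>.

Definition linear_ext (f : seq I -> tensor_algebra) (x : tensor_algebra) :
    tensor_algebra :=
  \sum_(w <- msupp x) x@_w *: f w.

Fact linear_ext_is_linear f : linear (linear_ext f).
Proof.
have E (D : {fset {fmonom I}}) (x : tensor_algebra) : (msupp x `<=` D)%fset ->
    linear_ext f x = \sum_(w <- D) x@_w *: f w.
  move=> sxD; rewrite /linear_ext (big_fset_incl _ sxD) //= => w _.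
  by move/mcoeff_outdom->; rewrite scale0r.
move=> a x y; pose D := (msupp x `|` msupp y)%fset.
have sxD : (msupp x `<=` D)%fset by apply: fsubsetUl.
have syD : (msupp y `<=` D)%fset by apply: fsubsetUr.
have sD : (msupp (a *: x + y) `<=` D)%fset.
  apply/fsubsetP=> w; apply: contraLR => wD; rewrite -mcoeff_eq0 mcoeffD mcoeffZ.
  rewrite !mcoeff_outdom ?mulr0 ?addr0 //; apply: contra wD; exact: fsubsetP.
rewrite (E D) // (E D x) // (E D y) // scaler_sumr -big_split /=.
by apply: eq_bigr => w _; rewrite mcoeffD mcoeffZ scalerDl scalerA.
Qed.
HB.instance Definition _ f :=
  GRing.isLinear.Build F tensor_algebra tensor_algebra *:%R (linear_ext f)
    (linear_ext_is_linear f).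

(* c p q is the coefficient of p.1 (x) p.2 in the image of q.1 (x) q.2. *)
Variable c : I * I -> I * I -> F.

(* c acting on the tensor factors in positions k and k+1, counted from 0; the
   value on words that are too short is irrelevant. *)
Definition braid_word (k : nat) (w : seq I) : tensor_algebra :=
  if drop k w is a :: b :: v
  then \sum_p c p (a, b) *: tensor (take k w ++ [:: p.1, p.2 & v])
  else tensor w.

Definition braid_at (k : nat) : tensor_algebra -> tensor_algebra :=
  linear_ext (braid_word k).

(* A reduced expression of w is chosen; the result does not depend on it when c
   satisfies the braid equation. *)
Definition braid_perm (m : nat) (w : 'S_m) : tensor_algebra -> tensor_algebra :=
  foldr (fun k : 'I_m.-1 => comp (braid_at k)) id (reduced_expression w).

(* The direct sum over m of the maps \sum_(w in S_m) c_w of V^{(x)m}; as it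
   preserves degrees, its kernel is the direct sum of their kernels. *)
Definition quantum_symmetrizer : tensor_algebra -> tensor_algebra :=
  linear_ext (fun u => \sum_(w : 'S_(size u)) braid_perm w (tensor u)).

Fact quantum_symmetrizer_is_linear : linear quantum_symmetrizer.
Proof. exact: linear_ext_is_linear. Qed.
HB.instance Definition _ :=
  GRing.isLinear.Build F tensor_algebra tensor_algebra *:%R quantum_symmetrizer
    quantum_symmetrizer_is_linear.

Definition nichols_ideal : {pred tensor_algebra} :=
  [pred x | quantum_symmetrizer x == 0].

Fact nichols_ideal_zmod : zmod_closed nichols_ideal.
Proof.
have mem x : (x \in nichols_ideal) = (quantum_symmetrizer x == 0) by [].
split=> [|x y]; rewrite !mem; first by apply/eqP; exact: linear0.
move=> /eqP Dx /eqP Dy; rewrite -[X in _ == X](subrr 0) -{1}Dx -Dy.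
by apply/eqP; exact: linearB.
Qed.
HB.instance Definition _ :=
  GRing.isZmodClosed.Build tensor_algebra nichols_ideal nichols_ideal_zmod.

(* Only the vector space structure of the quotient T(V) / ideal is set up. *)
Definition nichols : Type := Quotient.quot nichols_ideal.
HB.instance Definition _ := GRing.Zmodule.on nichols.

Definition to_nichols (x : tensor_algebra) : nichols :=
  (\pi_(Quotient.quot nichols_ideal) x)%qT.
Definition of_nichols (x : nichols) : tensor_algebra :=
  generic_quotient.repr (x : Quotient.quot nichols_ideal).

Lemma of_nicholsK : cancel of_nichols to_nichols.
Proof. by move=> x; rewrite /to_nichols /of_nichols reprK. Qed.

Lemma to_nichols_eq x y :
  (to_nichols x = to_nichols y) <-> (quantum_symmetrizer (x - y) = 0).
Proof.
split=> [/eqP|xy0]; last apply/eqP; rewrite -Quotient.idealrBE inE; first by move/eqP.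
exact/eqP.
Qed.

Lemma to_nicholsD : {morph to_nichols : x y / x + y}.
Proof. by move=> x y; rewrite /to_nichols Quotient.pi_add. Qed.

Definition nichols_scale (a : F) (x : nichols) : nichols :=
  to_nichols (a *: of_nichols x).

Lemma to_nicholsZ a x : to_nichols (a *: x) = nichols_scale a (to_nichols x).
Proof.
apply/to_nichols_eq; rewrite -scalerBr linearZ /=.
have /to_nichols_eq := esym (of_nicholsK (to_nichols x)).
by move=> ->; rewrite scaler0.
Qed.

Fact nichols_scaleA a b x :
  nichols_scale a (nichols_scale b x) = nichols_scale (a * b) x.
Proof. by rewrite -(of_nicholsK x) -!to_nicholsZ scalerA. Qed.

Fact nichols_scale1 : left_id 1 nichols_scale.
Proof. by move=> x; rewrite -(of_nicholsK x) -to_nicholsZ scale1r. Qed.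

Fact nichols_scaleDr : right_distributive nichols_scale +%R.
Proof.
move=> a x y; rewrite -(of_nicholsK x) -(of_nicholsK y).
by rewrite -to_nicholsD -!to_nicholsZ scalerDr to_nicholsD.
Qed.

Fact nichols_scaleDl x : {morph nichols_scale^~ x : a b / a + b}.
Proof.
by move=> a b; rewrite -(of_nicholsK x) -!to_nicholsZ scalerDl to_nicholsD.
Qed.

HB.instance Definition _ := GRing.Zmodule_isLmodule.Build F nichols
  nichols_scaleA nichols_scale1 nichols_scaleDr nichols_scaleDl.

End Nichols.

Definition infinite_dimensional (F : fieldType) (E : lmodType F) : Prop :=
  ~ exists s : seq E, forall x : E,
      exists a : 'I_(size s) -> F, x = \sum_i a i *: s`_i.

Section YetterDrinfeld.
Variables (F : fieldType) (gT : finGroupType).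

(* A finite-dimensional Yetter-Drinfeld module, given through a basis of
   homogeneous vectors: yd_act g i j is the coefficient of i in g . j. *)
Record yd_module := YDModule {
  yd_basis : finType;
  yd_deg : yd_basis -> gT;
  yd_act : gT -> yd_basis -> yd_basis -> F;
  yd_act1 : forall i j, yd_act 1%g i j = (i == j)%:R;
  yd_actM : forall g h i j,
    yd_act (g * h)%g i j = \sum_k yd_act g i k * yd_act h k j;
  yd_act_deg : forall g i j,
    yd_act g i j != 0 -> yd_deg i = (g * yd_deg j * g^-1)%g
}.

(* x (x) y |-> (deg x . y) (x) x *)
Definition yd_braiding (M : yd_module) (p q : yd_basis M * yd_basis M) : F :=
  if p.2 == q.1 then yd_act (yd_deg q.1) p.1 q.2 else 0.

Definition nichols_yd (M : yd_module) : lmodType F := nichols (@yd_braiding M).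

Section Irreducible.
Variables (s : gT) (d : nat) (rho : mx_representation F 'C[s]%g d).

Local Notation class_type := {t : gT | t \in (s ^: [set: gT])%g}.

Fact class_conj_exists (t : class_type) : exists g, (g * s * g^-1 == val t)%g.
Proof.
by case: t => t /= /imsetP[g _ ->]; exists g^-1%g; rewrite conjgE invgK mulgA.
Qed.

Definition class_conj (t : class_type) : gT := xchoose (class_conj_exists t).

Lemma class_conjP t : (class_conj t * s * (class_conj t)^-1)%g = val t.
Proof. exact/eqP/(xchooseP (class_conj_exists t)). Qed.

(* The pair (t, k) is g_t v_k, where v_1, ..., v_d is the standard basis of the
   space of column vectors, on which rho acts by left multiplication. The
   library states irreducibility of rho with row vectors; transposing shows
   that this is the same condition. *)
Definition class_module_act (g : gT) (i j : class_type * 'I_d) : F :=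
  if val i.1 == (g * val j.1 * g^-1)%g
  then rho ((class_conj i.1)^-1 * g * class_conj j.1)%g i.2 j.2 else 0.

Fact class_gamma_cent g (t u : class_type) : val u = (g * val t * g^-1)%g ->
  ((class_conj u)^-1 * g * class_conj t)%g \in 'C[s]%g.
Proof.
rewrite -!class_conjP => E; apply/cent1P; rewrite /commute.
have -> : (s * ((class_conj u)^-1 * g * class_conj t) =
  (class_conj u)^-1 * (class_conj u * s * (class_conj u)^-1)
  * g * class_conj t)%g by rewrite !mulgA mulVg mul1g.
by rewrite E !mulgA !mulgKV.
Qed.

Fact class_module_act1 i j : class_module_act 1%g i j = (i == j)%:R.
Proof.
rewrite /class_module_act mul1g invg1 mulg1 val_eqE.
case: i j => [t k] [u l] /=; rewrite xpair_eqE; case: eqP => //= ->.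
by rewrite mulg1 mulVg repr_mx1 mxE.
Qed.

Fact class_module_actM g h i j : class_module_act (g * h)%g i j =
  \sum_k class_module_act g i k * class_module_act h k j.
Proof.
case: j => u l; have cl_hu : (h * val u * h^-1)%g \in (s ^: [set: gT])%g.
  case: u => u /= /imsetP[x _ ->]; apply/imsetP; exists (x * h^-1)%g.
    exact: in_setT.
  by rewrite !conjgE invMg invgK !mulgA.
pose v : class_type := 
  exist (fun t => t \in (s ^: [set: gT])%g) _ cl_hu.
rewrite -(pair_big predT predT (fun t m => class_module_act g i (t, m)
  * class_module_act h (t, m) (u, l))) /= (bigD1 v) //= [X in _ + X]big1 ?addr0.
  rewrite /class_module_act /= eqxx invMg !mulgA.
  case: eqP => [Di|_]; last by rewrite big1 // => m _; rewrite mul0r.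
  have gv : val i.1 = (g * val v * g^-1)%g by rewrite /= Di !mulgA.
  have hu : val v = (h * val u * h^-1)%g by [].
  have -> : ((class_conj i.1)^-1 * g * h * class_conj u)%g =
    ((class_conj i.1)^-1 * g * class_conj v
     * ((class_conj v)^-1 * h * class_conj u))%g by rewrite !mulgA mulgK.
  by rewrite repr_mxM ?class_gamma_cent // mxE.
move=> t t'v; apply: big1 => m _; rewrite /class_module_act /=.
case: (val t =P _) => [Dt|]; last by rewrite mulr0.
by case/eqP: t'v; apply: val_inj.
Qed.

Fact class_module_act_deg g i j : class_module_act g i j != 0 ->
  val i.1 = (g * val j.1 * g^-1)%g.
Proof. by rewrite /class_module_act; case: ifP => [/eqP//|]; rewrite eqxx. Qed.

Definition class_module : yd_module :=
  @YDModule (class_type * 'I_d)%type (fun i => val i.1) class_module_act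
    class_module_act1 class_module_actM class_module_act_deg.

End Irreducible.
End YetterDrinfeld.

(* Main.v *)
From HB Require Import structures.
Require Import Defs.
From mathcomp Require Import all_boot all_order all_algebra all_fingroup.
From mathcomp Require Import mxrepresentation.
From mathcomp Require Import reals.
From mathcomp Require Import complex.
From mathcomp Require Import spectral finmap monalg zify ring.

(** Write s for the permutation, and V for the space of the representation rho
    of its centralizer. Suitable translates of a vector of V that is an
    eigenvector of the right elements of the centralizer span a braided subspace
    of diagonal type: one with a basis x_j such that
    c (x_j (x) x_l) = q_jl x_l (x) x_j. Its Nichols algebra embeds in that of the whole module (quantum_symmetrizer_embed), so it is
    enough to find a diagonal subspace with an infinite-dimensional Nichols
    algebra.

    For a diagonal braiding, c_w multiplies a word by the product of the q_jl
    over its inverted pairs of letters, because the letters of a reduced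
    expression of w match the inversions of w. Splitting the sum over w according
    to the letter moved to the last place shows that the kernel of the quantum
    symmetrizer is stable under skew derivations D_i of the tensor algebra
    (diag_sym_sderiv), which obey D_i (x y) = x D_i y + D_i x (g_i . y).

    Suppose now that z is homogeneous, and that a composite D of skew
    derivations sends z to a nonzero constant c, in such a way that all the D_i
    of the composite except the first kill z, and the product of the twists g_i
    fixes z. Then D p(z) = c p'(z) for all polynomials p (acts_as_derivativeI).
    If some nonzero p(z) were in the kernel, then so would be its iterated
    derivatives, down to a nonzero constant; hence the powers of z are
    independent in the Nichols algebra, which is infinite-dimensional. Such a z
    is an elementary stand-in for an imaginary root vector of an affine root
    system.

    Let v be an eigenvector of rho s in V, with eigenvalue q.
    - If q = 1, then z = x_1 in the span of v alone.
    - If q is neither 1 nor -1, then s and s^-1 are different, and conjugate as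
      for every permutation; v and a translate of degree s^-1 have braiding
      q_ii = q and q_12 q_21 = q^-2, of affine type A_1^(1), and z is the
      braided commutator of x_1 and x_2 (rank2_derivative).
    - If q = -1, then the order of s is even, so that s = t1 tau with t1 a
      product of two disjoint transpositions (a b)(c d) and tau of odd order
      fixing a, b, c, d. The permutations t2 = (a c)(b d) and t3 = t1 t2
      commute with t1, and the three t_i tau are conjugate by a 3-cycle that
      commutes with tau. Translates of an eigenvector of t2 in the eigenspace
      of s have braiding q_ii = -1, q_ij q_ji = -1, of affine type A_2^(1), and
      z = [x_1, [x_2, x_3]] (triangle_derivative). *)

Set Implicit Arguments.
Unset Strict Implicit.
Unset Printing Implicit Defensive.

Import GRing.Theory.
Local Open Scope ring_scope.

(** * Inversions and reduced expressions *)

Section Inversions.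
Variable m : nat.
Implicit Types (w : 'S_m) (k : 'I_m.-1) (a b : 'I_m).

(** An inversion is recorded by the two values rather than by the two positions:
    in this form, multiplying w by a simple transposition on the left leaves
    the other inversions literally unchanged. *)
Definition inversion w (p : 'I_m * 'I_m) : bool :=
  (p.1 < p.2)%N && ((w^-1)%g p.2 < (w^-1)%g p.1)%N.

Definition inversions w : {set 'I_m * 'I_m} := [set p | inversion w p].

Definition descent w k : bool := (w (Ordinal (adj_hi k)) < w (Ordinal (adj_lo k)))%N.

Lemma adjK k : (adj k * adj k = 1)%g.
Proof. exact: tperm2. Qed.

Lemma adjV k : ((adj k)^-1 = adj k)%g.
Proof. exact: tpermV. Qed.

Lemma ltn_adj k a b : (a, b) != (Ordinal (adj_lo k), Ordinal (adj_hi k)) ->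
  (b, a) != (Ordinal (adj_lo k), Ordinal (adj_hi k)) ->
  (adj k a < adj k b)%N = (a < b)%N.
Proof.
rewrite !xpair_eqE -!val_eqE /= => n1 n2; rewrite /adj !permE /= -!val_eqE /=.
case: (altP (a =P k :> nat)) n1 n2 => [->|ak];
  case: (altP (b =P k :> nat)) => [->|bk] //=;
  try case: (altP (b =P k.+1 :> nat)) => [->|bk1] //=;
  try case: (altP (a =P k.+1 :> nat)) => [->|ak1] //=; rewrite ?eqxx //= => *; lia.
Qed.

(** Prefixing a simple transposition at an ascent creates exactly one inversion;
    this one fact yields both the length formula and, later, the scalar by which
    a reduced expression acts in a diagonal braiding. *)
Lemma inversions_adjM w k : ~~ descent w k ->
  inversions (adj k * w) =
  (w (Ordinal (adj_lo k)), w (Ordinal (adj_hi k))) |: inversions w.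
Proof.
set x := Ordinal (adj_lo k); set y := Ordinal (adj_hi k).
rewrite /descent -/x -/y -leqNgt => wxy.
have xy : x != y by rewrite -val_eqE /= neq_ltn ltnSn.
have lt_wxy : (w x < w y)%N.
  by rewrite ltn_neqAle wxy andbT val_eqE (inj_eq perm_inj).
apply/setP=> -[a b]; rewrite in_setU1 !inE /inversion /= invMg adjV !permM.
have [[-> ->]|/eqP nab] := (a, b) =P (w x, w y).
  by rewrite !permK lt_wxy /adj tpermL tpermR /= ltnSn.
rewrite /=; have [lt_ab|//] := boolP (a < b)%N; rewrite /= ltn_adj //.
  by apply/eqP=> -[bx ay]; move: lt_ab lt_wxy; rewrite /x /y -bx -ay !permKV; lia.
by apply/eqP=> -[ax by_]; move: nab; rewrite /x /y -ax -by_ !permKV eqxx.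
Qed.

Lemma card_inversions_adj w k : ~~ descent w k ->
  #|inversions (adj k * w)| = #|inversions w|.+1.
Proof.
move=> wk; rewrite inversions_adjM // cardsU1 inE /inversion /= !permK /=.
by rewrite (ltnNge k.+1) leqnSn andbF.
Qed.

Lemma descent_adjM w k : descent (adj k * w) k = ~~ descent w k.
Proof.
rewrite /descent !permM /adj tpermL tpermR -leqNgt ltn_neqAle val_eqE.
by rewrite (inj_eq perm_inj) -val_eqE /= neq_ltn ltnSn.
Qed.

Lemma card_inversions_descent w k : descent w k ->
  #|inversions w| = #|inversions (adj k * w)|.+1.
Proof.
move=> wk; rewrite -(@card_inversions_adj _ k) ?descent_adjM ?negbK //.
by rewrite mulgA adjK mul1g.
Qed.

Lemma inversions1 : inversions 1 = set0.
Proof.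
by apply/setP=> p; rewrite !inE /inversion invg1 !perm1; case: ltngtP.
Qed.

(** Such a permutation is increasing. *)
Lemma no_descent_eq1 w : (forall k, ~~ descent w k) -> w = 1%g.
Proof.
move=> nd.
have step i (lt_i : (i.+1 < m)%N) : (w (Ordinal (ltnW lt_i)) < w (Ordinal lt_i))%N.
  have lt_k : (i < m.-1)%N by lia.
  have := nd (Ordinal lt_k); rewrite /descent -leqNgt leq_eqVlt.
  case/orP=> [/eqP/val_inj/perm_inj/(congr1 val)/= /n_Sn//|].
  by congr (_ < _)%N; congr (val (w _)); apply: val_inj.
have ge_w i (lt_i : (i < m)%N) : (i <= w (Ordinal lt_i))%N.
  elim: i lt_i => // i IHi lt_i; exact: leq_ltn_trans (IHi _) (step i lt_i).
have le_w d i (lt_i : (i < m)%N) : (m = i + d.+1)%N -> (w (Ordinal lt_i) <= i)%N.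
  elim: d i lt_i => [|d IHd] i lt_i Dm.
    have := ltn_ord (w (Ordinal lt_i)); lia.
  have lt_i1 : (i.+1 < m)%N by lia.
  have := step i lt_i1; have := IHd _ lt_i1.
  rewrite (_ : Ordinal (ltnW lt_i1) = Ordinal lt_i); last exact: val_inj.
  by move: (w _) (w _) => x y /(_ _); lia.
apply/permP=> -[i lt_i]; rewrite perm1; apply/val_inj/eqP.
by rewrite /= eqn_leq ge_w andbT (le_w (m - i.+1)%N) //; lia.
Qed.

(** Bubble sort: removing a descent removes one inversion. *)
Lemma expression_inversions w :
  exists2 s, w = (\prod_(k <- s) adj k)%g & size s = #|inversions w|.
Proof.
have [n] := ubnP #|inversions w|; elim: n w => // n IHn w lt_w.
have [/forallP nd|/forallPn[k]] := boolP [forall k, ~~ descent w k].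
  by exists [::]; rewrite (no_descent_eq1 nd) ?big_nil // inversions1 cards0.
rewrite negbK => wk; have Dw := card_inversions_descent wk.
have [|s Ds sz] := IHn (adj k * w)%g; first lia.
exists (k :: s); last by rewrite /= sz Dw.
by rewrite big_cons -Ds mulgA adjK mul1g.
Qed.

Lemma card_inversions_prod (s : seq 'I_m.-1) :
  (#|inversions (\prod_(k <- s) adj k)| <= size s)%N.
Proof.
elim: s => [|k s IHs]; first by rewrite big_nil inversions1 cards0.
rewrite big_cons /=; have [wk|wk] := boolP (descent (\prod_(k <- s) adj k)%g k).
  by move: IHs; rewrite (card_inversions_descent wk) => /ltnW/leqW.
by rewrite card_inversions_adj.
Qed.

(** The suffixes of a reduced expression are therefore reduced, and each of its
    letters creates a new inversion. *)
Lemma size_reduced_expression w :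
  size (reduced_expression w) = #|inversions w|.
Proof.
have [s Ds sz] := expression_inversions w; apply/eqP.
rewrite eqn_leq -{1}sz reduced_expression_min //=.
by have := card_inversions_prod (reduced_expression w); rewrite -reduced_expressionP.
Qed.

End Inversions.

(** * Linear maps *)

Section LinearMaps.
Variable F : fieldType.

Lemma linear_zero (U V : lmodType F) (f : U -> V) : linear f -> f 0 = 0.
Proof.
move=> f_lin; have := f_lin (-1) 0 0; rewrite scaler0 addr0 scaleN1r.
by rewrite addNr.
Qed.

Lemma linear_scale (U V : lmodType F) (f : U -> V) a (x : U) : linear f -> f (a *: x) = a *: f x.
Proof. by move=> f_lin; rewrite -[a *: x]addr0 f_lin linear_zero ?addr0. Qed.

Lemma linear_sum_scale (U V : lmodType F) (f : U -> V) (K : Type) (r : seq K)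
    (a : K -> F) (h : K -> U) : linear f ->
  f (\sum_(k <- r) a k *: h k) = \sum_(k <- r) a k *: f (h k).
Proof.
move=> f_lin; have f0 := linear_zero f_lin.
elim/big_rec2: _ => // k y1 y2 _ <-; exact: f_lin.
Qed.

Fact comp_linear (U V E : lmodType F) (f : V -> E) (g : U -> V) :
  linear f -> linear g -> linear (fun x => f (g x)).
Proof. by move=> f_lin g_lin k x y; rewrite g_lin f_lin. Qed.

Fact mul_r_linear (A : algType F) (x : A) : linear (fun y => y * x).
Proof. by move=> k y z; rewrite mulrDl -scalerAl. Qed.

Fact scale_linear (U : lmodType F) k : linear (fun x : U => k *: x).
Proof. by move=> a x y; rewrite scalerDr !scalerA mulrC. Qed.

Fact sum_scale_exchange (U : lmodType F) (K L : finType) (a : K -> F)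
    (b : L -> K -> F) (t : L -> U) :
  \sum_k a k *: (\sum_l b l k *: t l) = \sum_l (\sum_k b l k * a k) *: t l.
Proof.
under eq_bigr => k _ do rewrite scaler_sumr.
rewrite exchange_big; apply: eq_bigr => l _; rewrite scaler_suml.
by apply: eq_bigr => k _; rewrite scalerA mulrC.
Qed.

Lemma mul_sum_mul (A : algType F) (K : finType) (x y : A) (a : K -> F) (t : K -> A) :
  x * ((\sum_k a k *: t k) * y) = \sum_k a k *: (x * (t k * y)).
Proof.
rewrite mulr_suml mulr_sumr; apply: eq_bigr => k _.
by rewrite -scalerAl -scalerAr.
Qed.

Fact mul_mul_linear (A : algType F) (x t : A) : linear (fun y => x * (t * y)).
Proof. by move=> k y z; rewrite mulrDr -scalerAr mulrDr -scalerAr. Qed.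

Fact foldr_linear (U : lmodType F) (K : Type) (f : K -> U -> U) (r : seq K) :
  (forall k, linear (f k)) -> linear (foldr (fun k => comp (f k)) id r).
Proof.
move=> f_lin; elim: r => [|k r IHr] a x y; first reflexivity.
exact: etrans (congr1 (f k) (IHr a x y)) (f_lin k _ _ _).
Qed.

Lemma sum_delta (J : finType) (i : J) (a : J -> F) : \sum_j (j == i)%:R * a j = a i.
Proof.
rewrite (bigD1 i) //= eqxx mul1r big1 ?addr0 // => j /negPf->.
by rewrite mul0r.
Qed.

Fact mul_linear_r (A : algType F) (f : {linear A -> A}) x : linear (fun y => f (x * y)).
Proof. by move=> a u v; rewrite mulrDr -scalerAr linearP. Qed.

Fact mul_linear_l (A : algType F) (f : {linear A -> A}) y : linear (fun x => f (x * y)).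
Proof. by move=> a u v; rewrite mulrDl -scalerAl linearP. Qed.

Fact leibniz_linear_r (A : algType F) (f g h k : {linear A -> A}) x :
  linear (fun y => f x * g y + h x * k y).
Proof.
by move=> a u v; rewrite !linearP /= !mulrDr -!scalerAr scalerDr addrACA.
Qed.

Fact leibniz_linear_l (A : algType F) (f g h k : {linear A -> A}) y :
  linear (fun x => f x * g y + h x * k y).
Proof.
by move=> a u v; rewrite !linearP /= !mulrDl -!scalerAl scalerDr addrACA.
Qed.

(** The step, for a word starting with l, of the induction behind the twisted
    Leibniz rule. *)
Fact leibniz_cons (A : algType F) (k a b : F) (tl tu tv dv du : A) :
  k * (a * b) *: (tu * tv) + tl * (tu * dv + du * (b *: tv)) =
  tl * tu * dv + (k * a *: tu + tl * du) * (b *: tv).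
Proof.
rewrite mulrDr mulrDl !mulrA addrCA; congr (_ + (_ + _)).
by rewrite -scalerAl -scalerAr scalerA.
Qed.

End LinearMaps.

(** * The tensor algebra *)

Section TensorAlgebra.
Variables (F : fieldType) (I : finType).
Local Notation T := (tensor_algebra F I).
Implicit Types (x y : T) (u v w : seq I).

HB.instance Definition _ := GRing.Lalgebra.on T.

Lemma tensorM u v : tensor F u * tensor F v = tensor F (u ++ v).
Proof. by rewrite /tensor malgM_def fgmulUU mulr1 /mmul /= fmmulE. Qed.

Lemma tensor0 : tensor F [::] = 1 :> T.
Proof. by rewrite /tensor -fmoneE. Qed.

Lemma mcoeff_tensor u (w : {fmonom I}) : (tensor F u)@_w = (u == w)%:R.
Proof. by rewrite /tensor mcoeffU1. Qed.

Lemma tensorE x : x = \sum_(w <- msupp x) x@_w *: tensor F w.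
Proof.
rewrite {1}[x]monalgE; apply: eq_bigr => w _; apply/malgP=> v.
by rewrite mcoeffZ mcoeff_tensor mcoeffU mulr_natr.
Qed.

Lemma eq_linear_tensor (V : lmodType F) (f g : T -> V) : linear f -> linear g ->
  (forall w, f (tensor F w) = g (tensor F w)) -> f =1 g.
Proof.
move=> f_lin g_lin fg x; rewrite [x]tensorE !linear_sum_scale //.
by apply: eq_bigr => w _; rewrite fg.
Qed.

Fact tensor_scalerAr (a : F) x y : a *: (x * y) = x * (a *: y).
Proof.
have mulC z : a *: z = z * a%:MP.
  rewrite -mul_malgC !malgM_def fgmulUg fgmulgU.
  by apply: eq_bigr => w _; rewrite mulrC mul1m mulm1.
by rewrite !mulC mulrA.
Qed.

HB.instance Definition _ := GRing.Lalgebra_isAlgebra.Build F T tensor_scalerAr.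

(** Unlike linear_ext, this allows any target space. *)
Definition word_ext (E : lmodType F) (f : seq I -> E) (x : T) : E :=
  \sum_(w <- msupp x) x@_w *: f w.

Lemma word_ext_tensor (E : lmodType F) (f : seq I -> E) u :
  word_ext f (tensor F u) = f u.
Proof.
by rewrite /word_ext msuppU1 big_seq_fset1 mcoeff_tensor eqxx scale1r.
Qed.

Fact word_ext_is_linear (E : lmodType F) (f : seq I -> E) : linear (word_ext f).
Proof.
have ext (D : {fset {fmonom I}}) x : (msupp x `<=` D)%fset ->
    word_ext f x = \sum_(w <- D) x@_w *: f w.
  move=> sxD; rewrite /word_ext (big_fset_incl _ sxD) //= => w _.
  by move/mcoeff_outdom->; rewrite scale0r.
move=> a x y; pose D := (msupp x `|` msupp y)%fset.
have sxD : (msupp x `<=` D)%fset by apply: fsubsetUl.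
have syD : (msupp y `<=` D)%fset by apply: fsubsetUr.
have sD : (msupp (a *: x + y) `<=` D)%fset.
  apply: fsubset_trans (msuppD_le _ _) _; rewrite fsubUset syD andbT.
  exact: fsubset_trans (msuppZ_le _ _) sxD.
rewrite !(ext D) // scaler_sumr -big_split /=.
by apply: eq_bigr => w _; rewrite mcoeffD mcoeffZ scalerDl scalerA.
Qed.

HB.instance Definition _ (E : lmodType F) (f : seq I -> E) :=
  GRing.isLinear.Build F T E *:%R (word_ext f) (word_ext_is_linear f).

Lemma linear_ext_tensor (f : seq I -> T) u : linear_ext f (tensor F u) = f u.
Proof. exact: (word_ext_tensor (E := T)). Qed.

End TensorAlgebra.

(** * Twisted Leibniz rules *)

Section Leibniz.
Variables (F : fieldType) (A : algType F) (J : eqType).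
Variables (D G : J -> {linear A -> A}).

(** D_i obeys the Leibniz rule twisted by the algebra morphism G_i. *)
Definition skew_derivations : Prop := forall i,
  [/\ forall x y, D i (x * y) = x * D i y + D i x * G i y,
      forall x y, G i (x * y) = G i x * G i y & G i 1 = 1].

(** The derivations of s are applied from left to right. *)
Definition deriv_along (s : seq J) (x : A) : A := foldl (fun y i => D i y) x s.

(** Equivalently, p(z) is sent to c p'(z) for all polynomials p. *)
Definition acts_as_derivative (s : seq J) (z : A) (c : F) : Prop :=
  forall n, deriv_along s (z ^+ n) = (n%:R * c) *: z ^+ n.-1.

Hypothesis DG : skew_derivations.

Lemma derivM i x y : D i (x * y) = x * D i y + D i x * G i y.
Proof. by have [->] := DG i. Qed.

Lemma twistM i x y : G i (x * y) = G i x * G i y.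
Proof. by have [_ ->] := DG i. Qed.

Lemma twist1 i : G i 1 = 1.
Proof. by have [_ _ ->] := DG i. Qed.

Lemma deriv1 i : D i 1 = 0.
Proof.
have := derivM i 1 1; rewrite twist1 !mulr1 mul1r => D11.
by apply: (addrI (D i 1)); rewrite addr0 -D11.
Qed.

Fact deriv_along_is_linear s : linear (deriv_along s).
Proof. by elim: s => // i s IHs a x y; rewrite /deriv_along /= linearP; exact: IHs. Qed.
HB.instance Definition _ s :=
  GRing.isLinear.Build F A A *:%R (deriv_along s) (deriv_along_is_linear s).

Section Powers.
Variables (z : A) (d : J -> F) (i0 : J) (s : seq J) (c : F).
Hypotheses (z_twist : forall i, G i z = d i *: z)
  (z_deriv : {in s, forall i, D i z = 0})
  (zc : deriv_along (i0 :: s) z = c%:A)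
  (d1 : d i0 * \prod_(i <- s) d i = 1).

Lemma twistXn i n : G i (z ^+ n) = d i ^+ n *: z ^+ n.
Proof.
elim: n => [|n IHn]; first by rewrite twist1 scale1r.
by rewrite !exprS twistM IHn z_twist -scalerAl -scalerAr scalerA.
Qed.

(** Since D_i z = 0 for i in s, the derivations pass over z on the left and
    over the powers of z on the right, which they only rescale. *)
Lemma deriv_along_mul_exp x y n :
  deriv_along s (z * x + y * z ^+ n) =
  z * deriv_along s x + (\prod_(i <- s) d i) ^+ n *: (deriv_along s y * z ^+ n).
Proof.
elim: s z_deriv x y => [|i r IHr] z0 x y; first by rewrite big_nil expr1n scale1r.
have zi : D i z = 0 by apply: z0; exact: mem_head.
have zXn : D i (z ^+ n) = 0.
  elim: n {IHr} => [|n IHn]; first exact: deriv1.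
  by rewrite exprS derivM IHn zi mulr0 mul0r addr0.
rewrite /deriv_along /= !linearD /= !derivM zi zXn mul0r mulr0 addr0 add0r twistXn.
rewrite -scalerAr -/(deriv_along r _) scalerAl IHr; last first.
  by move=> j rj; apply: z0; rewrite inE rj orbT.
by rewrite big_cons linearZ /= -scalerAl scalerA -exprMn mulrC.
Qed.

(** The condition d1 says that the twists met along the whole sequence fix z:
    this is where the degree of z behaves like an imaginary root. Each of the n
    factors z of z ^+ n then contributes the same term c *: z ^+ n.-1. *)
Lemma acts_as_derivativeI : acts_as_derivative (i0 :: s) z c.
Proof.
have step m : deriv_along (i0 :: s) (z ^+ m.+1) =
    z * deriv_along (i0 :: s) (z ^+ m) + c *: z ^+ m.
  rewrite exprS {1}/deriv_along /= derivM twistXn -scalerAr scalerAl.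
  rewrite -/(deriv_along s _) deriv_along_mul_exp linearZ /= -scalerAl scalerA.
  rewrite -exprMn mulrC d1 expr1n scale1r.
  by move: zc; rewrite {1}/deriv_along /= -/(deriv_along s _) => ->; rewrite mulr_algl.
case; first by rewrite mul0r scale0r /deriv_along /= deriv1 -/(deriv_along s 0) linear0.
elim=> [|n IHn].
  rewrite step expr0 /deriv_along /= deriv1 -/(deriv_along s 0) linear0.
  by rewrite mulr0 add0r mul1r.
rewrite step IHn -scalerAr -exprS -scalerDl; congr (_ *: _).
by rewrite -[n.+2]addn1 natrD mulrDl mul1r.
Qed.

End Powers.

Lemma acts_as_derivative_sum s z c n (a : nat -> F) : acts_as_derivative s z c ->
  deriv_along s (\sum_(k < n.+1) a k *: z ^+ k) =
  \sum_(k < n) (a k.+1 * (k.+1%:R * c)) *: z ^+ k.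
Proof.
move=> der; rewrite linear_sum big_ord_recl /= linearZ /= der mul0r scale0r.
rewrite scaler0 add0r; apply: eq_bigr => k _.
by rewrite linearZ /= der scalerA.
Qed.

Section Generators.
Variables (x : J -> A) (q : J -> J -> F).
Hypotheses (Dx : forall i j, D i (x j) = (j == i)%:R)
  (Gx : forall i j, G i (x j) = q i j *: x j).

Lemma rank1_derivative i : q i i = 1 -> acts_as_derivative [:: i] (x i) 1.
Proof.
move=> qi; apply: (@acts_as_derivativeI (x i) (q^~ i)) => //.
  by rewrite /deriv_along /= Dx eqxx scale1r.
by rewrite big_nil mulr1.
Qed.

(** The braided commutator of x_i and x_j; this is the imaginary root vector of
    type A_1^(1) when q_ii = q_jj and q_ij q_ji = q_ii^-2. *)
Lemma rank2_derivative i j : i != j -> q i i * q i j * (q j i * q j j) = 1 ->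
  acts_as_derivative [:: j; i] (x i * x j - q i j *: (x j * x i))
    (1 - q i j * q j i).
Proof.
move=> ij q1; have ji : j != i by rewrite eq_sym.
apply: (@acts_as_derivativeI _ (fun k => q k i * q k j)).
- move=> k; rewrite linearB linearZ /= !twistM !Gx -!scalerAl -!scalerAr !scalerA.
  by rewrite scalerBr scalerA; congr (_ *: _ - _ *: _); ring.
- move=> k; rewrite inE => /eqP->; rewrite linearB linearZ /= !derivM !Dx !Gx.
  by rewrite eqxx (negPf ji) mulr0 add0r mul1r mul0r addr0 mulr1 subrr.
- rewrite /deriv_along /= !linearB !linearZ /= !derivM !Dx !Gx eqxx (negPf ij).
  rewrite mulr0 add0r mul0r addr0 mulr1 mul1r !linearZ /= Dx eqxx scalerA.
  by rewrite scalerN scalerBl scale1r (mulrC (q j i)).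
- by rewrite big_seq1 -q1; ring.
Qed.

(** A triangle with all q_ii = -1 and all q_ij q_ji = -1 is of type A_2^(1); the
    iterated braided commutator [x_i, [x_j, x_k]] is an imaginary root vector.
    Of the three derivations only D_k does not kill it, so D_k comes first. *)
Lemma triangle_derivative i j k : i != j -> j != k -> i != k ->
  q i i = -1 -> q j j = -1 -> q k k = -1 ->
  q i j * q j i = -1 -> q j k * q k j = -1 -> q i k * q k i = -1 ->
  let y := x j * x k - q j k *: (x k * x j) in
  acts_as_derivative [:: k; i; j] (x i * y - (q i j * q i k) *: (y * x i))
    (4%:R * q i j).
Proof.
move=> ij jk ik qi qj qk qij qjk qik y.
have ji : j != i by rewrite eq_sym.
have kj : k != j by rewrite eq_sym.
have ki : k != i by rewrite eq_sym.
pose dd l := q l i * (q l j * q l k).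
have Gy l : G l y = (q l j * q l k) *: y.
  rewrite /y linearB linearZ /= !twistM !Gx -!scalerAl -!scalerAr !scalerA.
  by rewrite scalerBr scalerA; congr (_ *: _ - _ *: _); ring.
have Diy : D i y = 0.
  rewrite /y linearB linearZ /= !derivM !Dx (negPf ji) (negPf ki).
  by rewrite !mulr0 !mul0r addr0 scaler0 subr0.
have Djy : D j y = 0.
  rewrite /y linearB linearZ /= !derivM !Dx !Gx eqxx (negPf kj).
  by rewrite mulr0 add0r mul1r mul0r addr0 mulr1 subrr.
have Dky : D k y = 2%:R *: x j.
  rewrite /y linearB linearZ /= !derivM !Dx !Gx eqxx (negPf jk).
  rewrite mulr0 mul0r addr0 add0r mulr1 mul1r scalerA qjk scaleN1r opprK.
  by rewrite scaler_nat mulr2n.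
apply: (@acts_as_derivativeI _ dd).
- move=> l; rewrite linearB linearZ /= !twistM !Gx Gy -!scalerAl -!scalerAr !scalerA.
  by rewrite scalerBr scalerA; congr (_ *: _ - _ *: _); rewrite /dd; ring.
- move=> l; rewrite !inE => /orP[] /eqP->; rewrite linearB linearZ /= !derivM !Dx Gx Gy.
    by rewrite Diy eqxx mul0r mulr0 add0r addr0 mul1r mulr1 subrr.
  by rewrite Djy (negPf ij) !mulr0 !mul0r addr0 scaler0 subr0.
- have Dkz : D k (x i * y - (q i j * q i k) *: (y * x i)) =
      2%:R *: (x i * x j + q i j *: (x j * x i)).
    rewrite linearB linearZ /= !derivM !Dx Gx Dky (negPf ik).
    rewrite mul0r mulr0 addr0 add0r -!scalerAr -!scalerAl !scalerA scalerDr scalerA.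
    congr (_ + _); rewrite -scaleNr; congr (_ *: _).
    by transitivity (- (2%:R * q i j * (q i k * q k i))); [ring | rewrite qik; ring].
  rewrite /deriv_along /= Dkz !(linearZ, linearD) /= !derivM !Dx !Gx eqxx (negPf ji).
  rewrite mulr0 mul0r mulr1 mul1r addr0 add0r linearZ /= Dx eqxx -scalerDl scalerA.
  by congr (_ *: _); ring.
- rewrite big_cons big_seq1 /dd qi qj qk.
  transitivity ((-1) ^+ 3 * ((q i j * q j i) * (q j k * q k j) * (q i k * q k i))).
    by ring.
  by rewrite qij qjk qik; ring.
Qed.
End Generators.
End Leibniz.

(** * Skew derivations of the tensor algebra *)

Section SkewDerivations.
Variables (F : fieldType) (J : finType) (q : J -> J -> F).
Local Notation T := (tensor_algebra F J).
Implicit Types (i j : J) (u v : seq J).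

(** The scalar by which moving a letter i to the right of the word u multiplies
    it. *)
Definition chi i u : F := \prod_(l <- u) q i l.

Definition twist i : T -> T := word_ext (fun u => chi i u *: tensor F u).

(** The sum of the results of moving an occurrence of i to the end of the word
    and deleting it there. *)
Fixpoint sderiv_word i u : T :=
  if u is l :: v then (l == i)%:R * chi i v *: tensor F v + tensor F [:: l] * sderiv_word i v
  else 0.

Definition sderiv i : T -> T := word_ext (sderiv_word i).

HB.instance Definition _ i := GRing.Linear.on (twist i).
HB.instance Definition _ i := GRing.Linear.on (sderiv i).

Lemma twist_tensor i u : twist i (tensor F u) = chi i u *: tensor F u.
Proof. exact: word_ext_tensor. Qed.

Lemma sderiv_tensor i u : sderiv i (tensor F u) = sderiv_word i u.
Proof. exact: word_ext_tensor. Qed.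

Lemma chi_cat i u v : chi i (u ++ v) = chi i u * chi i v.
Proof. exact: big_cat. Qed.

Lemma sderiv_word_cat i u v : sderiv_word i (u ++ v) =
  tensor F u * sderiv_word i v + sderiv_word i u * (chi i v *: tensor F v).
Proof.
elim: u => [|l u IHu] /=; first by rewrite tensor0 mul1r mul0r addr0.
rewrite IHu chi_cat -(tensorM F u v) -(cat1s l u) -(tensorM F [:: l] u).
exact: leibniz_cons.
Qed.

Fact bilinear_tensor (E : lmodType F) (f g : T -> T -> E) :
  (forall x, linear (f x)) -> (forall x, linear (g x)) ->
  (forall y, linear (f^~ y)) -> (forall y, linear (g^~ y)) ->
  (forall u v, f (tensor F u) (tensor F v) = g (tensor F u) (tensor F v)) ->
  forall x y, f x y = g x y.
Proof.
move=> flr glr fll gll fg x y; apply: (eq_linear_tensor (fll y) (gll y)) => u.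
by apply: (eq_linear_tensor (flr _) (glr _)) => v.
Qed.

Lemma sderiv_skew : skew_derivations sderiv twist.
Proof.
move=> i; split=> /=; last by rewrite -tensor0 twist_tensor /chi big_nil scale1r.
- apply: bilinear_tensor => [x|x|y|y|u v].
  + exact: mul_linear_r.
  + exact: (leibniz_linear_r idfun).
  + exact: mul_linear_l.
  + exact: (leibniz_linear_l idfun).
  + by rewrite tensorM twist_tensor !sderiv_tensor sderiv_word_cat.
- apply: bilinear_tensor => [x|x|y|y|u v].
  + exact: mul_linear_r.
  + by move=> a u v; rewrite linearP mulrDr -scalerAr.
  + exact: mul_linear_l.
  + by move=> a u v; rewrite linearP mulrDl -scalerAl.
  + by rewrite tensorM !twist_tensor chi_cat -scalerAl -scalerAr tensorM scalerA.
Qed.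

Definition gen j : T := tensor F [:: j].

Lemma sderiv_gen i j : sderiv i (gen j) = (j == i)%:R.
Proof.
by rewrite sderiv_tensor /= mulr0 addr0 /chi big_nil mulr1 tensor0 scaler_nat.
Qed.

Lemma twist_gen i j : twist i (gen j) = q i j *: gen j.
Proof. by rewrite twist_tensor /chi big_seq1. Qed.

End SkewDerivations.

(** * The quantum symmetrizer of a diagonal braiding *)

Section DiagonalSymmetrizer.
Variables (F : fieldType) (J : finType) (q : J -> J -> F).
Local Notation T := (tensor_algebra F J).

Definition inv_weight m (f : 'I_m -> J) (w : 'S_m) : F :=
  \prod_(p in inversions w) q (f p.1) (f p.2).

(** Words are taken as functions on 'I_m, so that permuting and deleting letters
    are compositions. *)
Definition sym_word m (f : 'I_m -> J) : T :=
  \sum_(w : 'S_m) inv_weight f w *: tensor F (codom (f \o w)).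

Definition diag_sym : T -> T :=
  word_ext (fun u => sym_word (tnth (in_tuple u))).
HB.instance Definition _ := GRing.Linear.on diag_sym.

Lemma eq_sym_word m (f g : 'I_m -> J) : f =1 g -> sym_word f = sym_word g.
Proof.
move=> fg; apply: eq_bigr => w _.
have -> : inv_weight f w = inv_weight g w by apply: eq_bigr => p _; rewrite !fg.
by rewrite (eq_codom (g := g \o w)) // => i; apply: fg.
Qed.

Lemma nth_codom_ord (K : Type) (x0 : K) m (f : 'I_m -> K) (i : 'I_m) :
  nth x0 (codom f) i = f i.
Proof. by rewrite (nth_map i) ?size_enum_ord ?nth_ord_enum. Qed.

Lemma diag_sym_codom m (f : 'I_m -> J) : diag_sym (tensor F (codom f)) = sym_word f.
Proof.
rewrite [LHS]word_ext_tensor.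
suff E u : size u = m -> u = codom f -> sym_word (tnth (in_tuple u)) = sym_word f.
  by apply: E; rewrite ?size_codom ?card_ord.
move=> Dm; case: m / Dm f => f Du; apply: eq_sym_word => i.
by rewrite (tnth_nth (f i)) /= -[RHS](nth_codom_ord (f i)) -Du.
Qed.

Lemma lift_perm_surj n (i j : 'I_n.+1) (s : 'S_n.+1) :
  s i = j -> exists t, s = lift_perm i j t.
Proof.
move=> si; pose g k := odflt k (unlift j (s (lift i k))).
have gK k : lift j (g k) = s (lift i k).
  rewrite /g; have := neq_lift i k.
  by rewrite -(can_eq (permK s)) si => /unlift_some[? ? ->].
have g_inj : injective g.
  move=> k l /(congr1 (lift j)); rewrite !gK => /perm_inj; exact: lift_inj.
exists (perm g_inj); apply/permP => k.
case: (unliftP i k) => [k'|] ->; first by rewrite lift_perm_lift permE gK.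
by rewrite lift_perm_id si.
Qed.

Lemma lift_perm_inj n (i j : 'I_n.+1) : injective (lift_perm i j).
Proof.
move=> s t st; apply/permP=> k; apply: (@lift_inj _ j).
by rewrite -!(lift_perm_lift i) st.
Qed.

Lemma reindex_lift_perm (E : zmodType) n (i j : 'I_n.+1) (G : 'S_n.+1 -> E) :
  \sum_(s : 'S_n.+1 | s i == j) G s = \sum_t G (lift_perm i j t).
Proof.
rewrite (reindex (lift_perm i j)) /=.
  by apply: eq_bigl => t; rewrite lift_perm_id eqxx.
exists (fun s => odflt 1%g [pick t | lift_perm i j t == s]) => [t _|s /eqP si].
  by case: pickP => [t' /eqP/lift_perm_inj //|/(_ t)]; rewrite eqxx.
case: pickP => [t /eqP //|no_t]; have [t st] := lift_perm_surj si.
by have := no_t t; rewrite -st eqxx.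
Qed.

Lemma inv_weightE m (f : 'I_m -> J) w : inv_weight f w =
  \prod_a \prod_b (if inversion w (a, b) then q (f a) (f b) else 1).
Proof.
rewrite /inv_weight big_mkcond pair_big /=.
by apply: eq_bigr => -[a b] _; rewrite inE.
Qed.

Lemma ltn_lift n (k : 'I_n.+1) (a b : 'I_n) : (lift k a < lift k b)%N = (a < b)%N.
Proof. by rewrite !ltnNge /= leq_bump2. Qed.

(** The value k taken at the last position makes inversions with the values
    above it, and deleting it leaves the other inversions unchanged. *)
Lemma inv_weight_lift n (f : 'I_n.+1 -> J) (k : 'I_n.+1) (w : 'S_n) :
  inv_weight f (lift_perm ord_max k w) =
  (\prod_(l : 'I_n.+1 | (k < l)%N) q (f k) (f l)) * inv_weight (f \o lift k) w.
Proof.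
rewrite !inv_weightE (bigD1_ord k) //= /inversion /= lift_permV.
congr (_ * _).
  rewrite [RHS]big_mkcond; apply: eq_bigr => b _; rewrite lift_perm_id.
  case: (unliftP k b) => [b'|] ->; last by rewrite ltnn.
  by rewrite lift_perm_lift lift_max /= ltn_ord andbT.
apply: eq_bigr => a _; rewrite (bigD1_ord k) //= lift_perm_id lift_perm_lift.
rewrite lift_max (ltnNge n) (ltnW (ltn_ord _)) andbF mul1r.
apply: eq_bigr => b _; rewrite !lift_perm_lift ltn_lift !lift_max.
by [].
Qed.

Lemma codom_ordSr n (f : 'I_n.+1 -> J) :
  codom f = rcons (codom (f \o lift ord_max)) (f ord_max).
Proof.
rewrite /codom /image_mem enum_ordSr map_rcons -map_comp.
by congr rcons; apply: eq_map => i /=; congr f; apply: val_inj; exact: esym (lift_max i).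
Qed.

(** Sorting the permutations by the value k taken at the last position. *)
Lemma sym_word_rec n (f : 'I_n.+1 -> J) : sym_word f =
  \sum_(k : 'I_n.+1) (\prod_(l : 'I_n.+1 | (k < l)%N) q (f k) (f l)) *:
    (sym_word (f \o lift k) * gen F (f k)).
Proof.
rewrite /sym_word (partition_big (fun w : 'S_n.+1 => w ord_max) predT) //=.
apply: eq_bigr => k _; rewrite reindex_lift_perm mulr_suml scaler_sumr.
apply: eq_bigr => w _; rewrite inv_weight_lift -scalerAl scalerA tensorM.
rewrite codom_ordSr /= lift_perm_id -cats1.
have -> : codom ((f \o lift_perm ord_max k w) \o lift ord_max) =
    codom ((f \o lift k) \o w).
  by apply: eq_codom => i /=; rewrite lift_perm_lift.
reflexivity.
Qed.

Lemma codom_ordSl n (f : 'I_n.+1 -> J) :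
  codom f = f ord0 :: codom (f \o lift ord0).
Proof.
rewrite /codom /image_mem enum_ordSl /= -map_comp.
by [].
Qed.

Lemma sderiv_codom i n (f : 'I_n -> J) :
  sderiv q i (tensor F (codom f)) =
  \sum_(k | f k == i) (\prod_(l : 'I_n | (k < l)%N) q (f k) (f l)) *:
    tensor F (codom (f \o lift k)).
Proof.
rewrite sderiv_tensor; elim: n f => [|n IHn] f.
  by rewrite big1 => [|[]//]; rewrite /codom /image_mem (size0nil (size_enum_ord 0)).
rewrite {1}codom_ordSl /= IHn [RHS]big_mkcond big_ord_recl /=; congr (_ + _).
  case: eqP => [->|_]; last by rewrite mul0r scale0r.
  rewrite mul1r; congr (_ *: _); rewrite /chi [RHS]big_mkcond big_ord_recl /= mul1r.
  by rewrite big_map big_enum.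
rewrite mulr_sumr [LHS]big_mkcond; apply: eq_bigr => k _ /=.
case: n f k {IHn} => [|n] f k; first by case: k.
case: eqP => // _; rewrite -scalerAr tensorM; congr (_ *: tensor F _).
  rewrite [RHS]big_mkcond big_ord_recl /= mul1r [LHS]big_mkcond.
  by apply: eq_bigr.
rewrite [RHS]codom_ordSl /=; congr (f _ :: _); first exact: val_inj.
apply: eq_codom => l /=; congr f; apply: val_inj => /=.
by rewrite /bump /= ltnS addnCA.
Qed.

(** The term with the empty word is there because the symmetrizer fixes 1. *)
Lemma diag_sym_rec x :
  diag_sym x = x@_(FMonom [::]) *: 1 + \sum_i diag_sym (sderiv q i x) * gen F i.
Proof.
move: x; apply: eq_linear_tensor.
- exact: linearP.
- move=> a x y; rewrite mcoeffD mcoeffZ scalerDl scalerDr scalerA scaler_sumr.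
  rewrite addrACA; congr (_ + _); rewrite -big_split; apply: eq_bigr => i _ /=.
  by rewrite !linearP /= mulrDl scalerAl.
move=> u; rewrite mcoeff_tensor.
have -> : u = codom (tnth (in_tuple u)) by rewrite [RHS]map_tnth_enum.
move: (tnth _); move: (size u) => {u} [|n] f.
  have f0 : codom f = [::] by rewrite /codom /image_mem (size0nil (size_enum_ord 0)).
  rewrite f0 eqxx scale1r big1 ?addr0; last first.
    by move=> i _; rewrite sderiv_tensor linear0 mul0r.
  have -> : tensor F [::] = tensor F (codom f) by rewrite f0.
  rewrite diag_sym_codom /sym_word (big_pred1 1%g); last first.
    by move=> w; apply/esym/eqP/permP=> -[].
  by rewrite /inv_weight inversions1 big_set0 scale1r /codom /image_mem
    (size0nil (size_enum_ord 0)) tensor0.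
rewrite diag_sym_codom sym_word_rec codom_ordSl /= scale0r add0r.
rewrite -codom_ordSl (partition_big f predT) //=; apply: eq_bigr => i _.
rewrite sderiv_codom linear_sum mulr_suml; apply: eq_bigr => k /eqP <-.
by rewrite linearZ /= diag_sym_codom scalerAl.
Qed.

Lemma mcoeff_mul_gen (x : T) (j i : J) (u : seq J) :
  (x * gen F j)@_(FMonom (rcons u i)) = (j == i)%:R * x@_(FMonom u).
Proof.
move: x; apply: (@eq_linear_tensor F J F^o).
- by move=> a x y; rewrite mulrDl -scalerAl mcoeffD mcoeffZ.
- by move=> a x y; rewrite mcoeffD mcoeffZ mulrDr mulrCA.
move=> w; rewrite tensorM cats1 !mcoeff_tensor /= eqseq_rcons.
by rewrite -natrM mulnb andbC.
Qed.

(** The terms of diag_sym_rec end in different letters, so they cannot cancel: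
    the kernel of the symmetrizer is stable under the skew derivations. *)
Lemma diag_sym_sderiv i x : diag_sym x = 0 -> diag_sym (sderiv q i x) = 0.
Proof.
move=> x0; apply/malgP=> -[u]; rewrite mcoeff0.
have := congr1 (mcoeff (FMonom (rcons u i))) x0.
rewrite diag_sym_rec mcoeffD mcoeffZ -tensor0 mcoeff_tensor raddf_sum /=.
have -> /= : ([::] == rcons u i) = false by case: (u).
rewrite mulr0 add0r mcoeff0 => <-.
rewrite -(sum_delta i (fun j => (diag_sym (sderiv q j x))@_(FMonom u))).
by apply: eq_bigr => j _; rewrite mcoeff_mul_gen.
Qed.

Lemma diag_sym_deriv_along (s : seq J) x :
  diag_sym x = 0 -> diag_sym (deriv_along (sderiv q) s x) = 0.
Proof.
elim: s x => [|i s IHs] x; first by move->.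
move/(diag_sym_sderiv i); exact: IHs.
Qed.

Lemma diag_sym1 : diag_sym 1 = 1.
Proof.
rewrite diag_sym_rec -{1}tensor0 mcoeff_tensor eqxx scale1r big1 ?addr0 // => i _.
have -> : sderiv q i 1 = 0 by rewrite -tensor0 sderiv_tensor.
by rewrite linear0 mul0r.
Qed.

(** If p(z) is in the kernel, then so is c p'(z), and one descends to a nonzero
    constant, as the characteristic is 0. *)
Lemma diag_sym_free s z c n (a : nat -> F) : [pchar F] =i pred0 -> c != 0 ->
  acts_as_derivative (sderiv q) s z c ->
  diag_sym (\sum_(k < n) a k *: z ^+ k) = 0 -> forall k, (k < n)%N -> a k = 0.
Proof.
move=> F0 c0 der; elim: n a => [|n IHn] a a0; first by case.
have aS k : (k < n)%N -> a k.+1 = 0.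
  move=> lt_kn; have nz : k.+1%:R * c != 0.
    by rewrite mulf_neq0 // ((pcharf0P _).1 F0).
  apply: (mulIf nz); rewrite mul0r.
  apply: (IHn (fun k => a k.+1 * (k.+1%:R * c)) _ k lt_kn).
  have := diag_sym_deriv_along s a0.
  by rewrite (acts_as_derivative_sum _ _ der).
move: a0; rewrite big_ord_recl big1 ?addr0; last first.
  by move=> k _; rewrite aS ?scale0r // ltn_ord.
rewrite expr0 linearZ /= diag_sym1 => /eqP; rewrite scaler_eq0 oner_eq0 orbF.
by move/eqP=> a00 [|k] // /aS.
Qed.

End DiagonalSymmetrizer.

(** * Diagonal braided subspaces *)

Section Embedding.
Variables (F : fieldType) (I J : finType) (c : I * I -> I * I -> F).
Variables (phi : J -> I -> F) (q : J -> J -> F).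
Local Notation TI := (tensor_algebra F I).
Local Notation TJ := (tensor_algebra F J).

(** In terms of the vectors v_j with coordinates phi j, this says that
    c (v_j (x) v_l) = q_jl v_l (x) v_j. *)
Hypothesis braid_phi : forall j l p,
  \sum_r c p r * (phi j r.1 * phi l r.2) = q j l * (phi l p.1 * phi j p.2).

Definition vec j : TI := \sum_a phi j a *: tensor F [:: a].

Definition embed_word (u : seq J) : TI := \prod_(j <- u) vec j.

Definition embed : TJ -> TI := word_ext embed_word.
HB.instance Definition _ := GRing.Linear.on embed.

Lemma embed_tensor u : embed (tensor F u) = embed_word u.
Proof. exact: word_ext_tensor. Qed.

Lemma embed_word_cons j u : embed_word (j :: u) = vec j * embed_word u.
Proof. exact: big_cons. Qed.

Lemma embed_word_cat u v : embed_word (u ++ v) = embed_word u * embed_word v.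
Proof. exact: big_cat. Qed.

Lemma linear_vecP (E : lmodType F) (f g : TI -> E) j w : linear f -> linear g ->
  (forall a, f (tensor F (rcons w a)) = g (tensor F (rcons w a))) ->
  f (tensor F w * vec j) = g (tensor F w * vec j).
Proof.
move=> f_lin g_lin fg; rewrite /vec mulr_sumr.
have -> : \sum_a tensor F w * (phi j a *: tensor F [:: a]) =
    \sum_a phi j a *: tensor F (rcons w a).
  by apply: eq_bigr => a _; rewrite -scalerAr tensorM cats1.
rewrite !linear_sum_scale //; apply: eq_bigr => a _; rewrite fg; reflexivity.
Qed.

(** The vectors v_j are only seen through their coordinates, so a linear
    identity between tensors of degree m may be checked on basis words. *)
Lemma eq_linear_embed (E : lmodType F) (f g : TI -> E) m : linear f -> linear g ->
  (forall w : seq I, size w = m -> f (tensor F w) = g (tensor F w)) ->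
  forall u, size u = m -> f (embed_word u) = g (embed_word u).
Proof.
move=> f_lin g_lin fg u; rewrite -[embed_word u]mul1r -tensor0 -[size u]add0n.
have lin_r (h : TI -> E) x : linear h -> linear (fun y => h (y * x)).
  by move=> h_lin b y z; rewrite mulrDl -scalerAl; exact: h_lin.
rewrite -{1}[0%N]/(size ([::] : seq I)); elim: u [::] => [|j u IHu] w Dm.
  rewrite /embed_word big_nil mulr1; apply: fg; rewrite -Dm addn0; reflexivity.
rewrite embed_word_cons mulrA.
apply: (linear_vecP (f := fun y => f (y * embed_word u))
  (g := fun y => g (y * embed_word u))) => [||a]; try exact: lin_r.
by apply: IHu; rewrite size_rcons -Dm addSnnS.
Qed.

Lemma mul_vec2 (x y : TI) j l : x * (vec j * (vec l * y)) =
  \sum_(r : I * I) (phi j r.1 * phi l r.2) *: (x * (tensor F [:: r.1; r.2] * y)).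
Proof.
rewrite -mul_sum_mul (mulrA (vec j)); congr (_ * (_ * _)).
rewrite /vec mulr_suml; under eq_bigr do rewrite mulr_sumr.
rewrite pair_big /=; apply: eq_bigr => r _.
by rewrite -scalerAl -scalerAr scalerA tensorM.
Qed.

Lemma braid_at_tensor (w : seq I) a b (y : TI) :
  braid_at c (size w) (tensor F w * (tensor F [:: a; b] * y)) =
  tensor F w * ((\sum_p c p (a, b) *: tensor F [:: p.1; p.2]) * y).
Proof.
have lin_l : linear (fun y : TI => braid_at c (size w) (tensor F w * (tensor F [:: a; b] * y))).
  exact: comp_linear (linear_ext_is_linear _) (mul_mul_linear _ _).
apply: (eq_linear_tensor lin_l (mul_mul_linear _ _)) => v.
rewrite !tensorM /braid_at linear_ext_tensor /braid_word drop_size_cat ?take_size_cat //=.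
rewrite mul_sum_mul; apply: eq_bigr => p _.
rewrite !tensorM; reflexivity.
Qed.

Lemma braid_at_vec (w : seq I) j l (y : TI) :
  braid_at c (size w) (tensor F w * (vec j * (vec l * y))) =
  q j l *: (tensor F w * (vec l * (vec j * y))).
Proof.
have lin : linear (braid_at c (size w)) by exact: linear_ext_is_linear.
apply: etrans (congr1 (braid_at c (size w)) (mul_vec2 (tensor F w) y j l)) _.
apply: etrans _ (congr1 ( *:%R (q j l)) (esym (mul_vec2 (tensor F w) y l j))).
apply: etrans (linear_sum_scale _ _ _ lin) _.
have E r : braid_at c (size w) (tensor F w * (tensor F [:: r.1; r.2] * y)) =
    \sum_p c p r *: (tensor F w * (tensor F [:: p.1; p.2] * y)).
  case: r => a b; exact: etrans (braid_at_tensor _ _ _ _) (mul_sum_mul _ _ _ _).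
apply: etrans (eq_bigr _ (fun r _ => congr1 _ (E r))) _.
apply: etrans (sum_scale_exchange _ _ _) _.
apply: etrans (eq_bigr _ (fun p _ => congr1 ( *:%R^~ _) (braid_phi j l p))) _.
by rewrite scaler_sumr; apply: eq_bigr => p _; rewrite scalerA.
Qed.

Lemma braid_at_embed u j l v :
  braid_at c (size u) (embed_word (u ++ j :: l :: v)) =
  q j l *: embed_word (u ++ l :: j :: v).
Proof.
rewrite !embed_word_cat !embed_word_cons.
move: {2}(size u) (erefl (size u)) => m.
pose f x := braid_at c m (x * (vec j * (vec l * embed_word v))).
pose g x := q j l *: (x * (vec l * (vec j * embed_word v))).
have f_lin : linear f.
  apply: (comp_linear (f := braid_at c m)) (linear_ext_is_linear _) _.
  exact: (mul_r_linear (F := F)).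
have g_lin : linear g.
  exact: (comp_linear (@scale_linear F TI _) (mul_r_linear (F := F) _)).
move=> Dm; rewrite [in LHS]Dm; apply: (eq_linear_embed f_lin g_lin _ Dm) => w Dw.
by rewrite /f /g -Dw braid_at_vec.
Qed.
End Embedding.

Lemma codom_split (K : Type) m (g : 'I_m -> K) (k : 'I_m.-1) :
  codom g = take k (codom g) ++
    [:: g (Ordinal (adj_lo k)), g (Ordinal (adj_hi k)) & drop k.+2 (codom g)].
Proof.
rewrite -{1}(cat_take_drop k (codom g)); congr (_ ++ _).
have sz : size (codom g) = m by rewrite size_codom card_ord.
have x0 := g (Ordinal (adj_lo k)).
rewrite (drop_nth x0) ?sz ?adj_lo // (drop_nth x0) ?sz ?adj_hi //.
by rewrite (nth_codom_ord x0 g (Ordinal (adj_lo k))) (nth_codom_ord x0 g (Ordinal (adj_hi k))).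
Qed.

Lemma codom_adj (K : Type) m (g : 'I_m -> K) (k : 'I_m.-1) :
  codom (g \o adj k) = take k (codom g) ++
    [:: g (Ordinal (adj_hi k)), g (Ordinal (adj_lo k)) & drop k.+2 (codom g)].
Proof.
have sz (h : 'I_m -> K) : size (codom h) = m by rewrite size_codom card_ord.
have x0 := g (Ordinal (adj_lo k)).
rewrite [LHS](codom_split _ k) /=; congr (_ ++ [:: g _, g _ & _]).
- have lt_km := adj_lo k; apply: (@eq_from_nth _ x0); first by rewrite !size_takel ?sz // ltnW.
  rewrite size_takel ?sz ?(ltnW lt_km) // => i lt_ik.
  have lt_im := ltn_trans lt_ik lt_km; rewrite !nth_take //.
  rewrite (nth_codom_ord x0 _ (Ordinal lt_im)) (nth_codom_ord x0 _ (Ordinal lt_im)) /=.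
  by rewrite /adj tpermD // -val_eqE /= gtn_eqF // leqW.
- exact: tpermL.
- exact: tpermR.
apply: (@eq_from_nth _ x0) => [|i]; first by rewrite !size_drop !sz.
rewrite size_drop sz ltn_subRL => lt_im; rewrite !nth_drop.
rewrite (nth_codom_ord x0 _ (Ordinal lt_im)) (nth_codom_ord x0 _ (Ordinal lt_im)) /=.
by rewrite /adj tpermD // -val_eqE /=; apply/eqP; lia.
Qed.

Section Intertwining.
Variables (F : fieldType) (I J : finType) (c : I * I -> I * I -> F).
Variables (phi : J -> I -> F) (q : J -> J -> F).
Local Notation TI := (tensor_algebra F I).
Local Notation TJ := (tensor_algebra F J).

Hypothesis braid_phi : forall j l p,
  \sum_r c p r * (phi j r.1 * phi l r.2) = q j l * (phi l p.1 * phi j p.2).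

Lemma inv_weight_adjM m (f : 'I_m -> J) (w : 'S_m) (k : 'I_m.-1) : ~~ descent w k ->
  inv_weight q f (adj k * w) = inv_weight q f w *
    q (f (w (Ordinal (adj_lo k)))) (f (w (Ordinal (adj_hi k)))).
Proof.
move=> wk; rewrite /inv_weight inversions_adjM // big_setU1 1?mulrC //=.
by rewrite inE /inversion /= !permK (ltnNge k.+1) leqnSn andbF.
Qed.

Lemma braid_at_codom m (f : 'I_m -> J) (k : 'I_m.-1) :
  braid_at c k (embed_word phi (codom f)) =
  q (f (Ordinal (adj_lo k))) (f (Ordinal (adj_hi k))) *:
    embed_word phi (codom (f \o adj k)).
Proof.
have sz : size (take k (codom f)) = k :> nat.
  by rewrite size_takel // size_codom card_ord ltnW ?adj_lo.
rewrite codom_adj {1}(codom_split f k) -{1}sz; exact: braid_at_embed.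
Qed.

(** Each letter of a reduced expression exchanges two letters that have not yet
    been exchanged, so the scalars that it produces are those of the distinct
    inversions. *)
Lemma braid_along_codom m (f : 'I_m -> J) (s : seq 'I_m.-1) :
  size s = #|inversions (\prod_(k <- s) adj k)| ->
  foldr (fun k : 'I_m.-1 => comp (braid_at c k)) id s (embed_word phi (codom f)) =
  inv_weight q f (\prod_(k <- s) adj k) *:
    embed_word phi (codom (f \o (\prod_(k <- s) adj k)%g)).
Proof.
elim: s => [|k s IHs] /=.
  rewrite big_nil /inv_weight inversions1 big_set0 scale1r => _.
  by congr (embed_word _ _); apply: eq_codom => i /=; rewrite perm1.
rewrite big_cons; set w := (\prod_(l <- s) adj l)%g in IHs *.
have le_w : (#|inversions w| <= size s)%N := card_inversions_prod s.
have [wk|nwk] := boolP (descent w k).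
  rewrite (card_inversions_descent wk) in le_w.
  by move=> Dw; move: le_w; rewrite -Dw => /ltnW; rewrite ltnn.
rewrite card_inversions_adj // => -[Dw]; rewrite (IHs Dw).
apply: etrans (linear_scale _ _ (linear_ext_is_linear _)) _.
apply: etrans (congr1 ( *:%R _) (braid_at_codom _ _)) _.
have -> : codom (f \o (adj k * w)%g) = codom ((f \o w) \o adj k).
  by apply: eq_codom => i /=; rewrite permM.
rewrite scalerA /= inv_weight_adjM //; reflexivity.
Qed.

Lemma braid_perm_codom m (f : 'I_m -> J) (w : 'S_m) :
  braid_perm c w (embed_word phi (codom f)) =
  inv_weight q f w *: embed_word phi (codom (f \o w)).
Proof.
rewrite {2 3}(reduced_expressionP w); apply: braid_along_codom.
by rewrite -reduced_expressionP size_reduced_expression.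
Qed.

Lemma symmetrizer_size m (w : seq I) : size w = m ->
  quantum_symmetrizer c (tensor F w) = \sum_(s : 'S_m) braid_perm c s (tensor F w).
Proof. by move=> <-; rewrite /quantum_symmetrizer linear_ext_tensor. Qed.

(** The quantum symmetrizer of the large space restricts to that of the diagonal
    subspace, so Nichols algebras of subspaces embed. *)
Lemma quantum_symmetrizer_embed x :
  quantum_symmetrizer c (embed phi x) = embed phi (diag_sym q x).
Proof.
have qs_lin := quantum_symmetrizer_is_linear c.
have em_lin : linear (embed phi : TJ -> TI) by exact: linearP.
have ds_lin : linear (diag_sym q : TJ -> TJ) by exact: linearP.
apply: (eq_linear_tensor (comp_linear qs_lin em_lin) (comp_linear em_lin ds_lin)) => u.
rewrite embed_tensor.
have -> : u = codom (tnth (in_tuple u)) by rewrite [RHS]map_tnth_enum.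
move: (tnth _); move: (size u) => {u} m f.
rewrite diag_sym_codom /sym_word linear_sum_scale //.
have sum_lin : linear (fun y => \sum_(s : 'S_m) braid_perm c s y).
  move=> a y z; rewrite scaler_sumr -big_split; apply: eq_bigr => s _.
  by apply: foldr_linear => k; exact: linear_ext_is_linear.
have sz : size (codom f) = m by rewrite size_codom card_ord.
apply: etrans (eq_linear_embed phi qs_lin sum_lin (@symmetrizer_size m) sz) _.
apply: eq_bigr => w _; rewrite braid_perm_codom embed_tensor; reflexivity.
Qed.

Section Injectivity.
Variable pivot : J -> I.
Hypotheses (pivot0 : forall j, phi j (pivot j) != 0)
  (pivot_neq : forall j l, j != l -> phi j (pivot l) = 0).

Lemma mcoeff_vec_mul j (x : TI) i (w : seq I) :
  (vec phi j * x)@_(FMonom (i :: w)) = phi j i * x@_(FMonom w).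
Proof.
pose f (x : TI) : F^o := (vec phi j * x)@_(FMonom (i :: w)).
pose g (x : TI) : F^o := phi j i * x@_(FMonom w).
have f_lin : linear f by move=> a y z; rewrite /f mulrDr -scalerAr mcoeffD mcoeffZ.
have g_lin : linear g by move=> a y z; rewrite /g mcoeffD mcoeffZ mulrDr mulrCA.
apply: (eq_linear_tensor f_lin g_lin) => v; rewrite /f /g /vec mulr_suml raddf_sum /=.
rewrite mcoeff_tensor -(sum_delta i (fun a => phi j a * (v == w)%:R)).
apply: eq_bigr => a _; rewrite -scalerAl tensorM mcoeffZ mcoeff_tensor /= eqseq_cons.
by rewrite mulrCA -natrM mulnb.
Qed.

Lemma mcoeff_vec_mul0 j (x : TI) : (vec phi j * x)@_(FMonom [::]) = 0.
Proof.
pose f (x : TI) : F^o := (vec phi j * x)@_(FMonom [::]).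
have f_lin : linear f by move=> a y z; rewrite /f mulrDr -scalerAr mcoeffD mcoeffZ.
have g_lin : linear (fun _ : TI => 0 : F^o) by move=> a y z; rewrite scaler0 addr0.
apply: (eq_linear_tensor f_lin g_lin) => v; rewrite /f /vec mulr_suml raddf_sum /=.
by apply: big1 => a _; rewrite -scalerAl tensorM mcoeffZ mcoeff_tensor mulr0.
Qed.

Lemma mcoeff_embed_word (u v : seq J) :
  (embed_word phi v)@_(FMonom (map pivot u)) =
  (v == u)%:R * \prod_(j <- u) phi j (pivot j).
Proof.
elim: v u => [|j v IHv] [|l u].
- by rewrite /embed_word big_nil -tensor0 mcoeff_tensor /= big_nil mulr1.
- by rewrite /embed_word big_nil -tensor0 mcoeff_tensor /= mul0r.
- by rewrite embed_word_cons mcoeff_vec_mul0 mul0r.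
rewrite embed_word_cons mcoeff_vec_mul IHv eqseq_cons big_cons.
have [->|/pivot_neq->] := eqVneq j l; first by rewrite mulrCA.
by rewrite !mul0r.
Qed.

Lemma embed_inj x : embed phi x = 0 -> x = 0.
Proof.
move=> x0; apply/malgP => -[u]; rewrite mcoeff0.
pose k := \prod_(j <- u) phi j (pivot j).
have k0 : k != 0 by rewrite /k prodf_seq_neq0; apply/allP => j _ /=; apply: pivot0.
pose f (y : TJ) : F^o := (embed phi y)@_(FMonom (map pivot u)).
pose g (y : TJ) : F^o := y@_(FMonom u) * k.
have f_lin : linear f by move=> a y z; rewrite /f linearP mcoeffD mcoeffZ.
have g_lin : linear g by move=> a y z; rewrite /g mcoeffD mcoeffZ mulrDl -mulrA.
have : f x = g x.
  apply: (eq_linear_tensor f_lin g_lin) => v; rewrite /f /g embed_tensor.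
  by rewrite mcoeff_embed_word mcoeff_tensor.
by rewrite /f /g x0 mcoeff0 => /esym/eqP; rewrite mulf_eq0 (negPf k0) orbF => /eqP.
Qed.

End Injectivity.

End Intertwining.

(** * Infinite dimension *)

(** A space spanned by d vectors has no d + 1 independent ones: the coordinate
    matrix of d + 1 vectors has a nonzero left kernel. *)
Lemma infinite_dimensional_free (F : fieldType) (E : lmodType F) (e : nat -> E) :
  (forall n (a : nat -> F), \sum_(k < n) a k *: e k = 0 ->
     forall k, (k < n)%N -> a k = 0) ->
  infinite_dimensional E.
Proof.
move=> e_free [s s_span]; pose d := size s.
have [A eA] := fin_all_exists (fun k : 'I_d.+1 => s_span (e k)).
pose M := \matrix_(k < d.+1, i < d) A k i.
have ker0 : kermx M != 0.
  by rewrite kermx_eq0 -row_leq_rank -ltnNge ltnS rank_leq_col.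
pose u := nz_row (kermx M); have u0 : u != 0 by rewrite nz_row_eq0.
have uM : u *m M = 0 by apply/sub_kermxP; exact: nz_row_sub.
case/eqP: u0; apply/rowP=> k; rewrite mxE.
rewrite -[u 0 k](_ : u 0 (inord k) = _); last by rewrite inord_val.
apply: (e_free d.+1 (fun k => u 0 (inord k)) _ k (ltn_ord k)).
transitivity (\sum_(i < d) (u *m M) 0 i *: s`_i); last first.
  by rewrite uM big1 // => i _; rewrite mxE scale0r.
under [RHS]eq_bigr => i _ do rewrite mxE scaler_suml.
rewrite exchange_big; apply: eq_bigr => l _ /=; rewrite inord_val eA scaler_sumr.
by apply: eq_bigr => i _; rewrite scalerA mxE.
Qed.

Section DiagonalCriterion.
Variables (F : fieldType) (I J : finType) (c : I * I -> I * I -> F).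

Fact to_nichols_linear : linear (to_nichols c : tensor_algebra F I -> nichols c).
Proof. by move=> a x y; rewrite to_nicholsD to_nicholsZ. Qed.

Lemma to_nichols_eq0 (x : tensor_algebra F I) :
  to_nichols c x = 0 -> quantum_symmetrizer c x = 0.
Proof.
rewrite -(linear_zero to_nichols_linear) => /to_nichols_eq.
by rewrite subr0.
Qed.

(** The powers of z are linearly independent in the Nichols algebra. *)
Lemma infinite_nichols (phi : J -> I -> F) (q : J -> J -> F) (pivot : J -> I)
    (s : seq J) (z : tensor_algebra F J) (k : F) :
  [pchar F] =i pred0 ->
  (forall j l p, \sum_r c p r * (phi j r.1 * phi l r.2) =
                 q j l * (phi l p.1 * phi j p.2)) ->
  (forall j, phi j (pivot j) != 0) ->
  (forall j l, j != l -> phi j (pivot l) = 0) ->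
  k != 0 -> acts_as_derivative (sderiv q) s z k ->
  infinite_dimensional (nichols c).
Proof.
move=> F0 braid_phi piv0 piv_neq k0 der.
apply: (infinite_dimensional_free (e := fun n => to_nichols c (embed phi (z ^+ n)))).
move=> n a a0; apply: (diag_sym_free F0 k0 der).
have em_lin : linear (embed phi : tensor_algebra F J -> tensor_algebra F I).
  exact: linearP.
apply: (embed_inj piv0 piv_neq).
rewrite -(quantum_symmetrizer_embed braid_phi).
apply: to_nichols_eq0; rewrite -a0.
apply: etrans (congr1 (to_nichols c) (linear_sum_scale _ _ _ em_lin)) _.
exact: linear_sum_scale _ _ _ to_nichols_linear.
Qed.

End DiagonalCriterion.

(** * Diagonal subspaces of the Yetter-Drinfeld module of a class *)

Section ClassModule.
Variables (F : fieldType) (gT : finGroupType) (s : gT) (d : nat).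
Variable rho : mx_representation F 'C[s]%g d.
Local Notation M := (class_module rho).
Local Notation basis := (yd_basis M).
Local Notation class_type := {t : gT | t \in (s ^: [set: gT])%g}.

Definition conj_by (x : gT) : gT := (x * s * x^-1)%g.

(** The element x (x) v of the induced module, of degree x s x^-1: it is
    g_t (x) rho (g_t^-1 x) v for the chosen representative g_t of that degree
    t. *)
Definition coset_vector (v : 'cV[F]_d) (x : gT) (i : basis) : F :=
  if val i.1 == conj_by x then (rho ((class_conj i.1)^-1 * x)%g *m v) i.2 0 else 0.

Fact class_conj_cent (t : class_type) (x : gT) : val t = conj_by x ->
  ((class_conj t)^-1 * x)%g \in 'C[s]%g.
Proof.
move=> tx; apply/cent1P; rewrite /commute; apply: (mulgI (class_conj t)).
rewrite !mulgA mulgV mul1g class_conjP tx /conj_by mulgKV.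
by [].
Qed.

Fact conj_by_class x : conj_by x \in (s ^: [set: gT])%g.
Proof.
by apply/imsetP; exists x^-1%g; rewrite ?inE // conjgE invgK /conj_by mulgA.
Qed.

Lemma coset_vector_neq0 v x : v != 0 -> exists i, coset_vector v x i != 0.
Proof.
move=> v0; pose t : class_type := exist (fun t => t \in (s ^: [set: gT])%g) _ (conj_by_class x).
have tx : val t = conj_by x by [].
have [/forallP z|/forallPn[k kP]] :=
    boolP [forall k, (rho ((class_conj t)^-1 * x)%g *m v) k 0 == 0].
  case/eqP: v0; rewrite -[v](mulKmx (repr_mx_unit rho (class_conj_cent tx))).
  rewrite [X in _ *m X](_ : _ = 0) ?mulmx0 //.
  by apply/colP=> k; rewrite (eqP (z k)) mxE.
by exists (t, k); rewrite /coset_vector /= eqxx.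
Qed.

(** As g x = x (x^-1 g x), the element g acts on x (x) v as x^-1 g x on v. *)
Lemma act_coset_vector v x (g : gT) (a : F) (i : basis) :
  (x^-1 * g * x)%g \in 'C[s]%g -> rho (x^-1 * g * x)%g *m v = a *: v ->
  \sum_b yd_act g i b * coset_vector v x b = a * coset_vector v x i.
Proof.
move=> cent_h h_v.
pose t : class_type := exist (fun t => t \in (s ^: [set: gT])%g) _ (conj_by_class x).
have tx : val t = conj_by x by [].
have gt : (g * val t * g^-1)%g = val t.
  rewrite tx /conj_by; have /cent1P := cent_h; rewrite /commute => h.
  have -> : (g * (x * s * x^-1) * g^-1 = x * ((x^-1 * g * x) * s) * x^-1 * g^-1)%g.
    by rewrite !mulgA mulgV mul1g.
  by rewrite h !mulgA !mulgK.
case: i => u k.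
rewrite -(pair_big predT predT (fun (u' : class_type) (m : 'I_d) =>
  class_module_act rho g (u, k) (u', m) * coset_vector v x ((u', m) : basis))) /=.
rewrite (bigD1 t) //= [X in _ + X]big1 ?addr0; last first.
  move=> u' u't; apply: big1 => m _; rewrite /coset_vector /= -tx val_eqE (negPf u't).
  by rewrite mulr0.
rewrite /class_module_act /coset_vector /= -tx gt val_eqE.
have [->|_] := eqVneq u t; last by rewrite mulr0 big1 // => m _; rewrite mul0r.
rewrite eqxx; set y := class_conj t.
have cent_yx := class_conj_cent tx.
have cent_ygy := class_gamma_cent (esym gt).
have E : (y^-1 * g * y * (y^-1 * x) = y^-1 * x * (x^-1 * g * x))%g.
  by rewrite !mulgA !mulgK.
have := congr1 (fun h => rho h *m v) E.
rewrite /= (repr_mxM rho cent_ygy cent_yx) (repr_mxM rho cent_yx cent_h).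
rewrite -!mulmxA h_v -scalemxAr => /(congr1 (fun w : 'cV_d => w k 0)).
by rewrite [LHS]mxE [RHS]mxE => <-.
Qed.

(** The vectors x_j (x) v span a diagonal braided subspace as soon as v is a
    common eigenvector of the elements x_l^-1 t_j x_l, with t_j = x_j s x_j^-1;
    they are independent since their degrees t_j differ. *)
Lemma infinite_class_module (J : finType) (x : J -> gT) (v : 'cV[F]_d)
    (q : J -> J -> F) (w : seq J) (z : tensor_algebra F J) (k : F) :
  [pchar F] =i pred0 -> v != 0 ->
  (forall j l, j != l -> conj_by (x j) != conj_by (x l)) ->
  (forall j l, ((x l)^-1 * conj_by (x j) * x l)%g \in 'C[s]%g /\
     rho ((x l)^-1 * conj_by (x j) * x l)%g *m v = q j l *: v) ->
  k != 0 -> acts_as_derivative (sderiv q) w z k ->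
  infinite_dimensional (nichols_yd M).
Proof.
move=> F0 v0 x_neq q_v k0 der.
have [pivot piv0] := fin_all_exists (fun j => coset_vector_neq0 (x j) v0).
apply: (infinite_nichols (phi := fun j => coset_vector v (x j)) (pivot := pivot)
  F0 _ piv0 _ k0 der) => [j l p|j l jl].
  have [cent_h h_v] := q_v j l.
  rewrite -(pair_big predT predT (fun a b => yd_braiding p (a, b) *
    (coset_vector v (x j) a * coset_vector v (x l) b))) /= (bigD1 p.2) //=.
  rewrite [X in _ + X]big1 ?addr0; last first.
    by move=> a /negPf ap; apply: big1 => b _; rewrite /yd_braiding /= eq_sym ap mul0r.
  have [jp|/eqP jp] := boolP (coset_vector v (x j) p.2 == 0).
    by rewrite (eqP jp) !mulr0 big1 // => b _; rewrite mul0r mulr0.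
  have Dp : val p.2.1 = conj_by (x j).
    by apply/eqP; apply: contra_notT jp; rewrite /coset_vector => /negPf->.
  rewrite mulrA -(act_coset_vector p.1 cent_h h_v) mulr_suml.
  by apply: eq_bigr => b _; rewrite /yd_braiding eqxx /= Dp mulrCA mulrC.
apply/eqP; apply: contraTT (piv0 l); rewrite /coset_vector.
case: ifP => [/eqP Dj _|_]; last by rewrite eqxx.
case: ifP => [/eqP|]; last by rewrite eqxx.
by rewrite Dj => E; move: (x_neq _ _ jl); rewrite E eqxx.
Qed.

End ClassModule.

(** * Conjugations in symmetric groups *)

Section PermReal.
Variables (T : finType) (s : {perm T}).

Definition orbit_rep x := odflt x [pick y in porbit s x].

Fact porbit_cycle g x : g \in <[s]>%g -> porbit s (g x) = porbit s x.
Proof. by case/cycleP=> i ->; rewrite porbit_perm. Qed.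

Fact orbit_repP x : exists2 g, g \in <[s]>%g & x = g (orbit_rep x).
Proof.
have : orbit_rep x \in porbit s x.
  by rewrite /orbit_rep; case: pickP => //= /(_ x); rewrite porbit_id.
by rewrite porbit_sym => /porbitP[i xi]; exists (s ^+ i)%g; rewrite ?mem_cycle.
Qed.

Fact orbit_rep_cycle g x : g \in <[s]>%g -> orbit_rep (g x) = orbit_rep x.
Proof.
move=> sg; rewrite /orbit_rep porbit_cycle //.
by case: pickP => //= /(_ x); rewrite porbit_id.
Qed.

(** Reverses each cycle around its representative: s^k r goes to s^-k r. *)
Definition orbit_flip x :=
  (odflt 1%g [pick g in <[s]>%g | g (orbit_rep x) == x])^-1%g (orbit_rep x).

Fact orbit_flipE g x : g \in <[s]>%g -> 
  orbit_flip (g (orbit_rep x)) = g^-1%g (orbit_rep x).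
Proof.
move=> sg; have [k sk xk] := orbit_repP x.
have repE h : h \in <[s]>%g -> orbit_rep (h (orbit_rep x)) = orbit_rep x.
  by move=> sh; rewrite orbit_rep_cycle // {2}xk orbit_rep_cycle.
rewrite /orbit_flip repE //; case: pickP => [h /andP[sh /eqP hg]|/(_ g)] /=; last first.
  by rewrite sg eqxx.
have comm : commute g h^-1 by apply: (centsP (cycle_abelian s)); rewrite ?groupV.
transitivity ((g * (h^-1 * g^-1))%g (orbit_rep x)).
  by rewrite mulgA comm mulgK.
by rewrite permM -hg -permM mulKVg.
Qed.

Lemma perm_conj_inv : exists x : {perm T}, (x * s * x^-1 = s^-1)%g.
Proof.
have flip_inj : injective orbit_flip.
  apply: (can_inj (g := orbit_flip)) => x; have [g sg xg] := orbit_repP x.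
  by rewrite xg orbit_flipE // orbit_flipE ?groupV // invgK.
pose h := perm flip_inj; exists h^-1%g; rewrite invgK.
have sh : (s * h = h * s^-1)%g.
  have hE y : h y = orbit_flip y by rewrite permE.
  apply/permP=> x; rewrite !permM !hE; have [g sg xg] := orbit_repP x.
  have comm : commute g^-1 s^-1.
    by apply: (centsP (cycle_abelian s)); rewrite ?groupV ?cycle_id.
  rewrite xg orbit_flipE // -!permM orbit_flipE ?groupM ?cycle_id //.
  by rewrite invMg -comm.
by rewrite -mulgA sh mulKg.
Qed.

End PermReal.

Section DoubleTransposition.
Variables (T : finType) (s : {perm T}).

Lemma perm_fix_commute (x y : T) (t : {perm T}) : t x = x -> t y = y ->
  commute (tperm x y) t.
Proof. by move=> tx ty; apply/commgP/conjg_fixP; rewrite tpermJ tx ty. Qed.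

Lemma permX_fix (x : T) (t : {perm T}) m : t x = x -> (t ^+ m)%g x = x.
Proof. by move=> tx; rewrite permX iter_fix. Qed.

Lemma porbit_size2 x : #|porbit s x| = 2 ->
  [/\ s x != x, s (s x) = x & forall y, y \in porbit s x -> y = x \/ y = s x].
Proof.
move=> sz; have := uniq_traject_porbit s x; rewrite sz /= inE andbT eq_sym => sx.
have := iter_porbit s x; rewrite sz /= => ssx; split=> // y.
by rewrite porbit_traject sz /= !inE => /orP[] /eqP; [left | right].
Qed.

Ltac tperm_simpl := repeat match goal with
  | |- context [fun_of_perm (tperm ?x ?y) ?z] => is_var z;
     first [rewrite (tpermL x y) | rewrite (tpermR x y)
           | rewrite (@tpermD _ x y z); [|by []|by []]]
  end.

(** With t1 = (a b)(c d) the product of the two transpositions and tau the odd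
    part of s, t1 = s^N for some odd N. The 3-cycle u on b, c, d commutes with
    tau and permutes cyclically t1, t2 = (a c)(b d) and t3 = (a d)(b c), and
    t3 = t1 t2; here t = t2. *)
Lemma double_transposition :
  (forall X : {set T}, X \in porbits s -> #|X| <> 2 -> odd #|X|) ->
  #|[set X in porbits s | #|X| == 2]| = 2 ->
  exists N (t u : {perm T}),
    [/\ odd N, commute t s, (t * t = 1)%g, (u ^+ 3 = 1)%g &
     [/\ (s ^ u = t * s ^+ N.+1)%g, (s ^ (u ^+ 2) = t * s)%g &
         uniq [:: s; (s ^ u)%g; (s ^ (u ^+ 2))%g]]].
Proof.
move=> odd_orb /eqP/cards2P[X [Y [XY orb2]]].
have memX : X \in [set X in porbits s | #|X| == 2] by rewrite orb2 !inE eqxx.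
have memY : Y \in [set X in porbits s | #|X| == 2] by rewrite orb2 !inE eqxx orbT.
move: memX memY; rewrite !inE.
case/andP=> /imsetP[a _ Xa] /eqP szX /andP[/imsetP[c _ Yc] /eqP szY].
rewrite Xa in szX; rewrite Yc in szY; set b := s a; set d := s c.
have [ba sb Xab] := porbit_size2 szX; have [dc sd Ycd] := porbit_size2 szY.
rewrite -/b -/d in ba sb Xab dc sd Ycd.
have porbS x : porbit s (s x) = porbit s x.
  by have := porbit_perm s 1 x; rewrite expg1.
have porb_ab : porbit s b = porbit s a := porbS a.
have porb_cd : porbit s d = porbit s c := porbS c.
have porb_neq : porbit s a != porbit s c by rewrite -Xa -Yc.
have ac : a != c by apply: contraNneq porb_neq => ->.
have ad : a != d by apply: contraNneq porb_neq => ->; rewrite porb_cd.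
have bc : b != c by apply: contraNneq porb_neq => bc; rewrite -porb_ab bc.
have bd : b != d by apply: contraNneq porb_neq => bd; rewrite -porb_ab bd porb_cd.
(* N is odd, and a multiple of the length of each odd cycle. *)
pose N := (\prod_(Z in porbits s | #|Z| != 2) #|Z|)%N.
have odd_N : odd N.
  rewrite /N; elim/big_ind: _ => // [m k om ok|Z /andP[sZ /eqP Z2]].
    by rewrite oddM om ok.
  exact: odd_orb.
pose t1 := (tperm a b * tperm c d)%g.
have ab : a != b by rewrite eq_sym.
have cd : c != d by rewrite eq_sym.
have [ca da cb db] : [/\ c != a, d != a, c != b & d != b].
  by split; rewrite eq_sym.
pose t2 := (tperm a c * tperm d b)%g.
pose t3 := (tperm a d * tperm b c)%g.
pose u := (tperm b c * tperm b d)%g.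
pose tau := (s ^+ N.+1)%g.
have t1E : [/\ t1 a = b, t1 b = a, t1 c = d & t1 d = c].
  by split; rewrite permM /=; tperm_simpl.
have uE : [/\ u a = a, u b = c, u c = d & u d = b].
  by split; rewrite permM /=; tperm_simpl.
have t2E : [/\ t2 a = c, t2 b = d, t2 c = a & t2 d = b].
  by split; rewrite permM /=; tperm_simpl.
have t3E : [/\ t3 a = d, t3 b = c, t3 c = b & t3 d = a].
  by split; rewrite permM /=; tperm_simpl.
pose out x := [&& a != x, b != x, c != x & d != x].
have t1o x : out x -> t1 x = x.
  by case/and4P=> *; rewrite permM; tperm_simpl.
have t2o x : out x -> t2 x = x.
  by case/and4P=> *; rewrite permM; tperm_simpl.
have t3o x : out x -> t3 x = x.
  by case/and4P=> *; rewrite permM; tperm_simpl.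
have uo x : out x -> u x = x.
  by case/and4P=> *; rewrite permM; tperm_simpl.
have eq4 (f g : {perm T}) : [/\ f a = g a, f b = g b, f c = g c & f d = g d] ->
    (forall x, out x -> f x = g x) -> f = g.
  case=> fa fb fc fd fo; apply/permP=> x.
  have [/fo //|] := boolP (out x).
  by rewrite !negb_and !negbK => /or4P[] /eqP<-.
have sN : (s ^+ N)%g = t1.
  have swapN x : s (s x) = x -> (s ^+ N)%g x = s x.
    move=> ssx; rewrite -[N]odd_double_half odd_N add1n expgS -muln2 mulnC expgM.
    by rewrite permM; apply: permX_fix; rewrite expgS expg1 permM ssx.
  apply: eq4 => [|x ox]; first by rewrite !swapN ?sb ?sd //; case: t1E.
  rewrite t1o //; have x2 : #|porbit s x| != 2.
    apply/negP=> x2; have : porbit s x \in [set X; Y].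
      by rewrite -orb2 inE x2 andbT; apply: imset_f.
    rewrite !inE Xa Yc !eq_porbit_mem => /orP[/Xab|/Ycd] [] xE;
      by move: ox; rewrite /out xE eqxx ?andbF.
  have : (#|porbit s x| %| N)%N.
    rewrite /N (bigD1 (porbit s x)) ?dvdn_mulr //=.
    by rewrite x2 andbT; apply: imset_f.
  case/dvdnP=> m ->; rewrite mulnC expgM; apply: permX_fix.
  by rewrite permX iter_porbit.
have tauE : tau = (s * t1)%g by rewrite /tau expgS sN.
have [ta tb tc td] : [/\ tau a = a, tau b = b, tau c = c & tau d = d].
  by rewrite tauE !(permM s) -/b -/d sb sd; case: t1E => -> -> -> ->.
have tau_comm x y : tau x = x -> tau y = y -> commute (tperm x y) tau.
  exact: perm_fix_commute.
have comm2 (f g : {perm T}) : commute f tau -> commute g tau -> commute (f * g) tau.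
  by move=> fc gc; rewrite /commute -mulgA gc mulgA fc mulgA.
have t1c : commute t1 tau by apply: comm2; apply: tau_comm.
have t2c : commute t2 tau by apply: comm2; apply: tau_comm.
have uc : commute u tau by apply: comm2; apply: tau_comm.
have t1D : t1 = (tperm a b * tperm c d)%g by [].
have t2D : t2 = (tperm a c * tperm d b)%g by [].
have t3D : t3 = (tperm a d * tperm b c)%g by [].
have tauD : tau = (s ^+ N.+1)%g by [].
clearbody t1 t2 t3 u tau.
case: t1E => t1a t1b t1c' t1d; case: t2E => t2a t2b t2c' t2d.
case: t3E => t3a t3b t3c' t3d; case: uE => ua ub uc' ud.
have t11 : (t1 * t1 = 1)%g.
  apply: eq4 => [|x ox]; last by rewrite permM perm1 !t1o.
  by rewrite !permM !perm1 t1a t1b t1c' t1d.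
have t22 : (t2 * t2 = 1)%g.
  apply: eq4 => [|x ox]; last by rewrite permM perm1 !t2o.
  by rewrite !permM !perm1 t2a t2b t2c' t2d.
have t21 : (t2 * t1 = t3)%g.
  apply: eq4 => [|x ox]; last by rewrite permM t2o // t1o // t3o.
  by rewrite !permM t2a t2b t2c' t2d t3a t3b t3c' t3d.
have t12 : (t1 * t2 = t3)%g.
  apply: eq4 => [|x ox]; last by rewrite permM t1o // t2o // t3o.
  by rewrite !permM t1a t1b t1c' t1d t3a t3b t3c' t3d.
have u3 : (u ^+ 3 = 1)%g.
  apply: eq4 => [|x ox]; last by rewrite !expgS expg0 mulg1 !permM perm1 !uo.
  by rewrite !expgS expg0 mulg1 !permM !perm1 !(ua, ub, uc', ud).
have sE : s = (t1 * tau)%g by rewrite t1c tauE -mulgA t11 mulg1.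
have su : (s ^ u = t2 * tau)%g.
  rewrite sE conjMg; congr (_ * _)%g; first by rewrite t1D conjMg !tpermJ ua ub uc' ud t2D.
  by apply/conjg_fixP/commgP/esym.
have su2 : (s ^ (u ^+ 2) = t3 * tau)%g.
  rewrite expgS expg1 conjgM su conjMg; congr (_ * _)%g.
    by rewrite t2D conjMg !tpermJ ua ub uc' ud t3D.
  by apply/conjg_fixP/commgP/esym.
exists N, t2, u; split=> //.
  by rewrite sE /commute mulgA t21 -mulgA -t2c mulgA t12.
split; [by rewrite su tauD | by rewrite su2 [in RHS]sE mulgA t21 |].
have sa : (t1 * tau)%g a = b by rewrite permM t1a.
have sua : (t2 * tau)%g a = c by rewrite permM t2a.
have su2a : (t3 * tau)%g a = d by rewrite permM t3a.
rewrite su su2 [in X in X :: _]sE /= !inE negb_or !andbT; apply/andP; split.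
  apply/andP; split; first by apply: contraNneq bc => E; rewrite -sa E sua.
  by apply: contraNneq bd => E; rewrite -sa E su2a.
by apply: contraNneq cd => E; rewrite -sua E su2a.
Qed.
End DoubleTransposition.

(** * Three diagonal subspaces *)

Section RealClass.
Variables (F : fieldType) (gT : finGroupType) (s : gT) (d : nat).
Variable rho : mx_representation F 'C[s]%g d.
Hypothesis F0 : [pchar F] =i pred0.

Lemma repr_expg_eigen x (v : 'cV[F]_d) q n : x \in 'C[s]%g ->
  rho x *m v = q *: v -> rho (x ^+ n)%g *m v = q ^+ n *: v.
Proof.
move=> cx xv; elim: n => [|n IHn]; first by rewrite repr_mx1 mul1mx scale1r.
by rewrite expgS repr_mxM ?groupX // -mulmxA IHn -scalemxAr xv scalerA exprSr.
Qed.

Lemma repr_invg_eigen x (v : 'cV[F]_d) q : x \in 'C[s]%g -> v != 0 ->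
  rho x *m v = q *: v -> q != 0 /\ rho x^-1%g *m v = q^-1 *: v.
Proof.
move=> cx v0 xv; have E : v = q *: (rho x^-1%g *m v).
  by rewrite scalemxAr -xv mulmxA -repr_mxM ?groupV // mulVg repr_mx1 mul1mx.
have q0 : q != 0 by apply: contraNneq v0 => q0; rewrite E q0 scale0r.
by split=> //; rewrite {2}E scalerA mulVf // scale1r.
Qed.

Lemma infinite_eigenvalue1 (v : 'cV[F]_d) : v != 0 -> rho s *m v = v ->
  infinite_dimensional (nichols_yd (class_module rho)).
Proof.
move=> v0 sv; pose q (_ _ : unit) : F := 1.
apply: (@infinite_class_module _ _ _ _ rho unit (fun _ => 1%g) v q [:: tt]
  (gen F tt) 1 F0 v0) => [[] []|[] []||].
- by rewrite eqxx.
- by rewrite /conj_by invg1 !mulg1 !mul1g sv scale1r (cent1id s).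
- exact: oner_neq0.
exact: (rank1_derivative (sderiv_skew q) (sderiv_gen q) (twist_gen q)).
Qed.

(** The vectors 1 (x) v and h (x) v, of degrees s and s^-1, have braiding matrix
    q_ii = q and q_12 = q_21 = q^-1. For q = 1, one of them is enough. *)
Lemma infinite_real (v : 'cV[F]_d) q h : v != 0 -> rho s *m v = q *: v ->
  (h * s * h^-1 = s^-1)%g -> q != -1 ->
  infinite_dimensional (nichols_yd (class_module rho)).
Proof.
move=> v0 sv hs qN1; have [q1|q1] := eqVneq q 1.
  by apply: (infinite_eigenvalue1 v0); rewrite sv q1 scale1r.
have [q0 sVv] := repr_invg_eigen (cent1id s) v0 sv.
have q2 : q ^+ 2 != 1 by rewrite sqrf_eq1 negb_or q1.
have s_neq : s != s^-1%g.
  apply: contraNneq q2 => sE; have := repr_expg_eigen 2 (cent1id s) sv.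
  have -> : (s ^+ 2 = 1)%g by rewrite expgS expg1 {2}sE mulgV.
  rewrite repr_mx1 mul1mx => /esym/eqP.
  by rewrite -subr_eq0 -{2}[v]scale1r -scalerBl scaler_eq0 (negPf v0) orbF subr_eq0.
have hVs : (h^-1 * s * h = s^-1)%g.
  by rewrite -[s in LHS]invgK -hs !invMg !invgK !mulgA mulVg mul1g mulgKV.
pose x (b : bool) := if b then h else 1%g.
pose qq (j l : bool) := if j == l then q else q^-1.
have conj_x b : conj_by s (x b) = if b then s^-1%g else s.
  by rewrite /conj_by /x; case: b; rewrite // mul1g invg1 mulg1.
apply: (@infinite_class_module _ _ _ _ rho bool x v qq [:: true; false]
  (gen F false * gen F true - qq false true *: (gen F true * gen F false))
  (1 - qq false true * qq true false) F0 v0) => [[] [] //|[] []||].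
- by rewrite !conj_x /= eq_sym.
- by rewrite !conj_x /=.
- have -> : ((x true)^-1 * conj_by s (x true) * x true = s)%g.
    by rewrite /conj_by !mulgA mulVg mul1g mulgKV.
  by rewrite /qq /=; split=> //; exact: cent1id.
- rewrite conj_x /= invg1 mul1g mulg1 /qq /=; split=> //; rewrite groupV; exact: cent1id.
- rewrite conj_x /= hVs /qq /=; split=> //; rewrite groupV; exact: cent1id.
- by rewrite conj_x /= invg1 mul1g mulg1 /qq /=; split=> //; exact: cent1id.
- rewrite /qq /= -expr2 subr_eq0 eq_sym exprVn invr_eq1; exact: q2.
apply: (@rank2_derivative _ _ _ _ _ (sderiv_skew qq) _ _ (sderiv_gen qq)
  (twist_gen qq) false true isT).
by rewrite /qq /= mulfV // mulVf // mul1r.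
Qed.

(** When s acts by -1 on v, one may also take v to be an eigenvector of t, as
    t * t = 1; its eigenvalue is e = 1 or e = -1. Then s, s ^ u and s ^ (u ^+ 2)
    act on v by -1, e and -e, and the vectors u^-j (x) v form a triangle with
    q_jj = -1 and q_jl q_lj = e * - e = -1. *)
Lemma infinite_triangle (v : 'cV[F]_d) (t u : gT) N : v != 0 ->
  rho s *m v = -1 *: v -> odd N -> commute t s -> (t * t = 1)%g -> (u ^+ 3 = 1)%g ->
  (s ^ u = t * s ^+ N.+1)%g -> (s ^ (u ^+ 2) = t * s)%g ->
  uniq [:: s; (s ^ u)%g; (s ^ (u ^+ 2))%g] ->
  infinite_dimensional (nichols_yd (class_module rho)).
Proof.
move=> v0 sv odd_N ts tt u3 su su2 s_uniq.
have ct : t \in 'C[s]%g by apply/cent1P.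
have cs := (cent1id s).
have [w [w0 sw [e [e2 tw]]]] : exists w : 'cV[F]_d, [/\ w != 0,
    rho s *m w = -1 *: w & exists e, e * e = 1 /\ rho t *m w = e *: w].
  have [tv|tv] := eqVneq (rho t *m v) (- v).
    by exists v; split=> //; exists (-1); rewrite mulrNN mulr1 scaleN1r.
  exists (v + rho t *m v); split; first by rewrite addrC addr_eq0.
    rewrite mulmxDr sv scalerDr; congr (_ + _).
    by rewrite mulmxA -repr_mxM // -ts repr_mxM // -mulmxA sv scalemxAr.
  exists 1; split; first by rewrite mulr1.
  by rewrite scale1r mulmxDr mulmxA -repr_mxM // tt repr_mx1 mul1mx addrC.
pose e3 (m : nat) : F := [:: -1; e; - e]`_m.
pose sm m := (s ^ (u ^+ m))%g.
have sm_mod m : sm m = sm (m %% 3)%N by rewrite /sm -(expg_mod _ u3).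
have sm_eigen m : (m < 3)%N -> sm m \in 'C[s]%g /\ rho (sm m) *m w = e3 m *: w.
  have csX k : (s ^+ k)%g \in 'C[s]%g by rewrite groupX.
  case: m => [|[|[|//]]] _; rewrite /sm /e3.
  - by rewrite conjg1.
  - rewrite expg1 su groupM //; split=> //.
    rewrite repr_mxM // -mulmxA (repr_expg_eigen _ cs sw) -scalemxAr tw scalerA.
    by rewrite -signr_odd /= odd_N mul1r.
  - rewrite su2 groupM //; split=> //.
    by rewrite repr_mxM // -mulmxA sw -scalemxAr tw scalerA mulN1r.
pose q (j l : 'I_3) := e3 ((j + (3 - l)) %% 3)%N.
pose x (j : 'I_3) := ((u ^+ j)^-1)%g.
have conj_x j : conj_by s (x j) = sm j.
  by rewrite /conj_by /x /sm invgK conjgE mulgA.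
have sm_conj (j l : 'I_3) : ((x l)^-1 * conj_by s (x j) * x l)%g = sm ((j + (3 - l)) %% 3)%N.
  rewrite conj_x /x invgK -sm_mod /sm expgD conjgM.
  have -> : (u ^+ (3 - l) = (u ^+ l)^-1)%g.
    by apply/esym/eqP; rewrite eq_invg_mul -expgD subnKC ?u3 // ltnW.
  by rewrite [RHS]conjgE invgK !mulgA.
pose i0 : 'I_3 := @Ordinal 3 0 isT; pose i1 : 'I_3 := @Ordinal 3 1 isT.
pose i2 : 'I_3 := @Ordinal 3 2 isT.
pose y := gen F i1 * gen F i2 - q i1 i2 *: (gen F i2 * gen F i1).
apply: (@infinite_class_module _ _ _ _ rho 'I_3 x w q [:: i2; i0; i1]
  (gen F i0 * y - (q i0 i1 * q i0 i2) *: (y * gen F i0)) (4%:R * q i0 i1) F0 w0).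
- move=> j l jl; rewrite !conj_x.
  move: s_uniq; rewrite /= !inE negb_or !andbT => /andP[/andP[n01 n02] n12].
  have [sm0 sm1] : sm 0%N = s /\ sm 1%N = (s ^ u)%g by rewrite /sm conjg1 expg1.
  case: j l jl => [[|[|[|//]]] ?] [[|[|[|//]]] ?] //= _;
    by rewrite ?sm0 ?sm1 // eq_sym.
- by move=> j l; rewrite sm_conj; apply: sm_eigen; rewrite ltn_mod.
- have e0 : e != 0 by apply: contra_eq_neq e2 => ->; rewrite mul0r eq_sym oner_neq0.
  rewrite mulf_neq0 ?((pcharf0P _).1 F0) //.
  by rewrite /q /e3 /= oppr_eq0.
have eN : e * - e = -1 by rewrite mulrN e2.
have Ne : - e * e = -1 by rewrite mulNr e2.
by apply: (triangle_derivative (sderiv_skew q) (sderiv_gen q) (twist_gen q)).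
Qed.

End RealClass.

Local Close Scope ring_scope.

Theorem theorem1 (R : realType) (n : nat) (pi : 'S_n) :
  odd #[pi]%g \/
  ((forall X : {set 'I_n}, X \in porbits pi -> #|X| <> 2 -> odd #|X|) /\
   #|[set X in porbits pi | #|X| == 2]| = 2) ->
  forall (d : nat) (rho : mx_representation (complex R) 'C[pi]%g d),
    mx_irreducible rho ->
    infinite_dimensional (nichols_yd (class_module rho)).
Proof.
move=> pi_cond d rho [_ rho0 _].
have d0 : (0 < d)%N.
  by case: d rho rho0 => // rho /eqP[]; apply/matrixP=> -[].
have F0 : [pchar complex R]%R =i pred0 := Num.Theory.pchar_num (complex R).
have [q /eigenvalueP[w wq w0]] := eigenvalue_closed (rho pi)^T%R d0.
have v0 : (w^T != 0)%R by rewrite trmx_eq0.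
have vq : (rho pi *m w^T = q *: w^T)%R by rewrite -[rho pi]trmxK -trmx_mul wq linearZ.
have [h hpi] := perm_conj_inv pi.
have [qN1|qN1] := eqVneq q (-1)%R; last first.
  exact (infinite_real F0 v0 vq hpi qN1).
rewrite {}qN1 in vq; case: pi_cond => [odd_pi|[odd_orb two_orb]].
  (* The eigenvalue -1 of an element of odd order would give v = - v. *)
  case/eqP: (v0); have := repr_expg_eigen #[pi]%g (cent1id pi) vq.
  rewrite expg_order repr_mx1 mul1mx -signr_odd odd_pi scaleN1r => /eqP.
  rewrite -subr_eq0 opprK -mulr2n -scaler_nat scaler_eq0 => /orP[|/eqP//].
  by rewrite ((pcharf0P _).1 F0).
have [N [t [u [odd_N tpi tt u3 [su su2 s_uniq]]]]] := double_transposition odd_orb two_orb.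
exact (infinite_triangle F0 v0 vq odd_N tpi tt u3 su su2 s_uniq).
Qed.
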